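(* Let $G=(V,E)$ be a countably infinite connected graph with finite degrees and let $p:\mathcal C_\to(G)\to[0,1]$ be a weight function on oriented cycles satisfying the uniform loop assumption (stated in the context). Then, $\mu_p$-almost surely, for every vertex $x\in V$, the connected component of $x$ is finite.
   Context: **Cycles.** $\mathcal C_\to(G)$ is the set of oriented simple cycles of $G$. A back-and-forth path $(v,u,v)$ along one edge is not a cycle and is by convention given weight $p=0$. A cycle-rooted spanning forest (CRSF) of $G$ is a subgraph containing all vertices, each of whose connected components contains exactly one cycle. **Uniform loop assumption** (for a weight function $w$; here $w=p$). There exist $\alpha>0$, $\beta>0$, $M,M'>0$, $C>0$, $d\in\mathbb N$, a family $\Gamma$ of oriented cycles of $G$, and for every $x\in V$ an increasing sequence $(B_n^x)_{n\ge1}$ of finite connected induced subgraphs of $G$ containing $x$ and exhausting $G$ such that: - for every $\gamma\in\Gamma$, $\alpha\le w(\gamma)\le1$; - for every $x\in V$, $n\ge1$ and $v\in\partial B_n^x$ there is a cycle $\gamma_v\in\Gamma$ with all vertices in $B_{n+1}^x\setminus(B_n^x\cup\partial B_{n+1}^x)$ such that the probability that a simple random walk started at $v$ makes this loop, i.e. $\mathbb P_v((X_1,\dots,X_{|\gamma_v|})=\gamma_v)$, is greater than $\beta$ (with $\gamma_v$ written as a closed vertex sequence $(x_1,\dots,x_k)$, $x_k=x_1$, $|\gamma_v|=k$); - for every $x\in V$ and $n\ge1$, $M'n\le d(x,\partial B_n^x)\le Mn$ and $|\partial B_n^x|\le Cn^d$. Here $\partial B$ is the set of vertices of $B$ having a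 neighbour in $G$ outside $B$, $d(\cdot,\cdot)$ is the graph distance, and $\mathbb P_v$ is the law of the simple random walk $(X_k)_{k\ge0}$ on $G$ with $X_0=v$. **$p$-loop-erased random walk with boundary condition $W\subset V$.** Let $(X_n)_{n\ge0}$ be a simple random walk on $G$ started at $x$ and $(Y_n)$ i.i.d. uniform on $[0,1]$, independent of $(X_n)$. Maintain a current self-avoiding path, initially $(x)$. At time $n+1$, if the current path is $(x_0,\dots,x_l)$ and $X_{n+1}\notin\{x_0,\dots,x_l\}$, append $X_{n+1}$. If $X_{n+1}=x_i$, a loop $\gamma=(x_i,\dots,x_l,x_i)$ is closed at time $n+1$: if $Y_{n+1}\le p(\gamma)$ the loop is kept and the walk stops; otherwise the loop is erased and the path becomes $(x_0,\dots,x_i)$. The walk also stops at $T_W=\min\{k\ge0:X_k\in W\}$. The $p$-loop-erased random walk with boundary condition $W$ is the path at the stopping time (together with the kept loop, if the walk stopped by keeping a loop). **The measure $\mu_p$.** Let $(v_i)_{i\ge1}$ be an enumeration of $V$. Take independent families $(X^{(x)}_n)_n$, $(Y^{(x)}_n)_n$, $x\in V$, where for each $x\in V$, $(X^{(x)}_n)_n$ is a simple random walk on $G$ started at $x$ and $(Y^{(x)}_n)_n$ is a sequence of i.i.d. random variables uniform on $[0,1]$. Put $\mathsf F_0=\emptyset$ and $\mathsf F_i=\mathsf F_{i-1}\cup L(v_i)$, where $L(v_i)$ is the $p$-loop-erased random walk started at $v_i$ built from $(X^{(v_i)},Y^{(v_i)})$ with boundary condition $V(\mathsf F_{i-1})$.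 Let $\mathsf F=\bigcup_i\mathsf F_i$, a random CRSF of $G$. Under the uniform loop assumption for $w=p$, its law on $\{0,1\}^E$ does not depend on the enumeration and is denoted $\mu_p$. *)

(* Defs.v *)
From HB Require Import structures.
From mathcomp Require Import all_boot all_order all_algebra finmap.
From mathcomp Require Import all_classical all_reals all_analysis.
Set Implicit Arguments.
Unset Strict Implicit.
Unset Printing Implicit Defensive.
Import Order.TTheory GRing.Theory Num.Theory.
Import numFieldNormedType.Exports.
Local Open Scope classical_set_scope.
Local Open Scope ring_scope.

(* Locally finite simple graph on V: undirected, no loops, no multiple edges. *)
Record lfgraph (V : choiceType) := LFGraph {
  adj : rel V;
  adj_sym : symmetric adj;
  adj_irr : irreflexive adj;
  adj_fin : forall x, finite_set [set y | adj x y] }.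

Section Graph.
Variables (V : choiceType) (G : lfgraph V).

Definition deg (x : V) : nat := #|` fset_set [set y | adj G x y]|.

(* A walk x = x_0, x_1, ..., x_k is given by x and the list (x_1, ..., x_k). *)
Definition connected_graph : Prop :=
  forall x y, exists2 s, path (adj G) x s & last x s = y.

(* Connectedness of the subgraph induced by B. *)
Definition connected_in (B : {fset V}) : Prop :=
  forall x y, x \in B -> y \in B ->
  exists s, [/\ path (adj G) x s, all (mem B) s & last x s = y].

Definition bdry (B : {fset V}) : {fset V} :=
  [fset v in B | `[< exists2 u, adj G v u & u \notin B >]]%fset.

Definition gdist (R : realType) (x y : V) : R :=
  inf [set (size s)%:R | s in [set s | path (adj G) x s /\ last x s = y]].

Definition gdist_set (R : realType) (x : V) (S : {fset V}) : R :=
  inf [set gdist R x y | y in [set` S]].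

Definition is_edge (e : {fset V}) : Prop :=
  exists x y, adj G x y /\ e = [fset x; y]%fset.

Definition edge : Type := {e : {fset V} | is_edge e}.

(* The list (x_1, ..., x_k) stands for the closed path (x_1, ..., x_k, x_1);
   a back-and-forth path (u, v, u) is excluded by the size condition. *)
Definition is_cycle (s : seq V) : bool :=
  [&& (2 < size s)%N, uniq s & cycle (adj G) s].

Definition rotations (s : seq V) : set (seq V) :=
  [set rot k s | k in [set: nat]].

(* An oriented simple cycle has no distinguished starting point: it is the
   class, up to rotation, of its rooted representatives. *)
Definition ocycle : Type :=
  {c : set (seq V) | exists2 s, is_cycle s & c = rotations s}.

Definition ocycle_of (s : seq V) (Hs : is_cycle s) : ocycle :=
  exist _ (rotations s) (ex_intro2 _ _ s Hs erefl).

Definition represents (s : seq V) (c : ocycle) : Prop := sval c s.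

End Graph.

(* (x_1, ..., x_k) |-> (x_1, ..., x_k, x_1) *)
Definition close_seq (V : Type) (s : seq V) : seq V :=
  if s is x :: _ then rcons s x else [::].

Section Walk.
Variables (R : realType) (V : choiceType) (G : lfgraph V).

Definition srw_step (x y : V) : R :=
  if adj G x y then (deg G x)%:R^-1 else 0.

(* P_x((X_1, ..., X_k) = (x_1, ..., x_k)) for the simple random walk. *)
Fixpoint srw_prob (x : V) (s : seq V) : R :=
  if s is y :: s' then srw_step x y * srw_prob y s' else 1.

(* X is a simple random walk on G started at x. *)
Definition is_srw d (T : measurableType d) (P : probability T R)
    (X : nat -> T -> V) (x : V) : Prop :=
  [/\ forall n y, measurable [set t | X n t = y],
      P [set t | X 0%N t = x] = 1%E &
      forall s : seq V,
        P [set t | X 0%N t = x /\ [seq X i t | i <- iota 1 (size s)] = s]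
        = (srw_prob x s)%:E].

Definition uniform_loop_assumption (w : ocycle G -> R) : Prop :=
  exists (alpha beta M M' C : R) (d : nat) (Gamma : set (ocycle G))
         (B : V -> nat -> {fset V}),
  [/\ [/\ 0 < alpha, 0 < beta, 0 < M, 0 < M' & 0 < C],
      forall x,
        [/\ forall n, (0 < n)%N -> x \in B x n /\ connected_in G (B x n),
            forall n, (0 < n)%N -> (B x n `<=` B x n.+1)%fset &
            forall y, exists2 n, (0 < n)%N & y \in B x n],
      forall c, Gamma c -> alpha <= w c <= 1,
      forall x n v, (0 < n)%N -> v \in bdry G (B x n) ->
        exists c s,
        [/\ Gamma c, represents s c,
            {subset s <= B x n.+1 `\` (B x n `|` bdry G (B x n.+1))}%fset &
            beta < srw_prob v (close_seq s)] &
      forall x n, (0 < n)%N ->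
        M' * n%:R <= gdist_set G R x (bdry G (B x n)) <= M * n%:R /\
        (#|` bdry G (B x n)|)%:R <= C * n%:R ^+ d].

End Walk.

Section LoopErasure.
Variables (R : realType) (V : choiceType) (G : lfgraph V).
Variable p : ocycle G -> R.

(* Weight of the closed path (x_1, ..., x_k, x_1); it is 0 when this is not a
   cycle, in particular for a back-and-forth path. *)
Definition loop_weight (s : seq V) : R :=
  match pselect (is_cycle G s) with
  | left Hs => p (ocycle_of Hs)
  | right _ => 0
  end.

(* Current path (x_0, ..., x_l), and the kept loop (x_i, ..., x_l, x_i) once a
   loop has been kept. *)
Definition lerw_state : Type := (seq V * option (seq V))%type.

Definition lerw_step (s : seq V) (v : V) (y : R) : lerw_state :=
  if v \notin s then (rcons s v, None)
  else let loop := drop (index v s) s in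
    if y <= loop_weight loop then (s, Some (close_seq loop))
    else (take (index v s).+1 s, None).

Section Trajectory.
Variables (X : nat -> V) (Y : nat -> R) (W : set V).

(* T_W <= n *)
Definition hit_by (n : nat) : Prop := exists2 k, (k <= n)%N & W (X k).

(* State at time n; it is frozen once the walk has stopped. *)
Fixpoint lerw (n : nat) : lerw_state :=
  if n is m.+1 then
    let st := lerw m in
    if isSome st.2 || `[< hit_by m >] then st
    else lerw_step st.1 (X m.+1) (Y m.+1)
  else ([:: X 0%N], None).

Definition lerw_stopped (n : nat) : Prop := isSome (lerw n).2 \/ hit_by n.

Definition path_edges (s : seq V) : set {fset V} :=
  [set [fset uv.1; uv.2]%fset | uv in [set` zip s (behead s)]].

Definition state_vertices (st : lerw_state) : set V := [set` st.1].

Definition state_edges (st : lerw_state) : set {fset V} :=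
  path_edges st.1 `|` (if st.2 is Some c then path_edges c else set0).

(* Vertices and edges of the loop-erased walk at its stopping time; both are
   empty if the walk never stops. *)
Definition lerw_vertices : set V :=
  [set v | exists2 n, lerw_stopped n & state_vertices (lerw n) v].

Definition lerw_edges : set {fset V} :=
  [set e | exists2 n, lerw_stopped n & state_edges (lerw n) e].

End Trajectory.

(* Vertices and edges of F_n, for the enumeration v 0, v 1, ... of V. *)
Fixpoint wilson (v : nat -> V) (X : V -> nat -> V) (Y : V -> nat -> R)
    (n : nat) : set V * set {fset V} :=
  if n is m.+1 then
    let F := wilson v X Y m in
    let x := v m in
    (F.1 `|` lerw_vertices (X x) (Y x) F.1,
     F.2 `|` lerw_edges (X x) (Y x) F.1)
  else (set0, set0).

End LoopErasure.

Section Configurations.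
Variables (V : choiceType) (G : lfgraph V).

Definition cylinders : set (set (edge G -> bool)) :=
  [set A | exists e, A = [set eta : edge G -> bool | eta e]].

(* {0,1}^E with its product sigma-algebra. *)
Definition config := g_sigma_algebraType cylinders.

Definition open_edge (eta : edge G -> bool) (x y : V) : bool :=
  `[< exists2 e : edge G, sval e = [fset x; y]%fset & eta e >].

Definition component (eta : edge G -> bool) (x : V) : set V :=
  [set y | exists2 s, path (open_edge eta) x s & last x s = y].

Definition wilson_config (R : realType) (p : ocycle G -> R) (v : nat -> V)
    (X : V -> nat -> V) (Y : V -> nat -> R) : edge G -> bool :=
  fun e => `[< exists n, (wilson p v X Y n).2 (sval e) >].

End Configurations.

Section Independence.
Variables (R : realType) (d : measure_display) (T : measurableType d).
Variable P : probability T R.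

(* Mutual independence of a family of sigma-algebras. *)
Definition independent (I : choiceType) (F : I -> set (set T)) : Prop :=
  forall (J : {fset I}) (A : I -> set T), (forall i, i \in J -> F i (A i)) ->
  P (\bigcap_(i in [set` J]) A i) = (\prod_(i <- J) P (A i))%E.

(* sigma(Z_n, n >= 0), where S is the sigma-algebra of the state space. *)
Definition sigma_process (U : Type) (S : set (set U)) (Z : nat -> T -> U) :
    set (set T) :=
  <<s \bigcup_n preimage_set_system [set: T] (Z n) S >>.

Definition iid_uniform (Y : nat -> {RV P >-> R}) : Prop :=
  (forall n A, measurable A ->
     distribution P (Y n) A = uniform_prob (@ltr01 R) A) /\
  independent (fun n => preimage_set_system [set: T] (Y n) measurable).

End Independence.

Section Mu.
Variables (R : realType) (V : choiceType) (G : lfgraph V).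

(* The independent walks X^(x) and uniform sequences Y^(x), x in V; the state
   space V of the walks carries its discrete sigma-algebra. *)
Definition driving_families d (T : measurableType d) (P : probability T R)
    (X : V -> nat -> T -> V) (Y : V -> nat -> {RV P >-> R}) : Prop :=
  [/\ forall x, is_srw G P (X x) x,
      forall x, iid_uniform (Y x) &
      independent P (fun i : V + V => match i with
        | inl x => sigma_process [set: set V] (X x)
        | inr x => sigma_process measurable (fun n => Y x n : T -> R)
        end)].

(* mu is the law on {0,1}^E of the subgraph F built from some enumeration of V
   and some choice of the driving families. *)
Definition is_mu (p : ocycle G -> R) (mu : probability (config G) R) : Prop :=
  exists (v : nat -> V) (d : measure_display) (T : measurableType d)
         (P : probability T R) (X : V -> nat -> T -> V)
         (Y : V -> nat -> {RV P >-> R}),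
  [/\ bijective v, driving_families X Y &
      forall A : set (config G), measurable A ->
        mu A = P [set t | A (wilson_config p v
                               (fun x n => X x n t) (fun x n => Y x n t))]].

End Mu.

(* Main.v *)
(* A state of Wilson's algorithm is a partial map sending a vertex to the next
   one on its branch.  Toppling a vertex u outside its domain adds an arrow from
   u to a uniform neighbour; if this closes a loop, the loop is kept with
   probability its weight and its arrows are erased otherwise.  Topplings at
   distinct vertices commute, so the conditional probability that the branch of
   y would hit z, were it built at once, is a supermartingale under any order of
   topplings.  Hence P(z lies on the branch of y) is at most the probability that
   the loop-erased walk from y hits z before keeping a loop.

   Going twice around a cycle closes it as a loop whatever the current path is, so
   that the walk is killed with a probability bounded below soon after each visit
   to a boundary vertex of an exhaustion, also when it is run backwards.  By
   reversibility, the sum over y in the boundary of B n of the above bound is at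
   most deg z times the expected number of visits of that boundary by the killed
   walk from z.  Before reaching it the walk has to cross many boundaries, so this
   tends to 0, and z has almost surely finitely many ancestors.  As every branch is
   finite, so are the components. *)
Require Import Defs.
From HB Require Import structures.
From mathcomp Require Import all_boot all_order all_algebra finmap.
From mathcomp Require Import all_classical all_reals all_analysis.
From mathcomp Require Import ring lra.
Set Implicit Arguments.
Unset Strict Implicit.
Unset Printing Implicit Defensive.
Import Order.TTheory GRing.Theory Num.Theory.
Import numFieldNormedType.Exports.
Local Open Scope classical_set_scope.
Local Open Scope ring_scope.

(** * Sums over the steps of the simple random walk *)

(** The survival probability of the loop-erased walk depends on its whole current path, so neither
    the Markov property nor reversibility applies to it. Its supremum over all current paths is a
    function of the word of steps alone; it is submultiplicative, and remains so when words are read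
    backwards. The estimates for the killed walk use nothing else about killing.

    The enumeration is fixed, and the vertex y of interest may come late in it. Its branch is
    compared with the one that would be built first at the level of constructions truncated after n
    topplings, where commutation is a finite statement; the inequality then passes to the limit.

    A walk may fail to stop, and the events of interest quantify over the resulting states. Their
    probabilities are therefore bounded through measurable covers, assembled from finite histories
    of the walks and of the uniform variables. *)

Section WalkSums.
Variables (R : realType) (V : choiceType) (G : lfgraph V).
Implicit Types (x y z v : V) (s w : seq V) (t : nat) (phi psi : seq V -> R).

Definition nbrs x : seq V := fset_set [set y | adj G x y].

Definition avg x (h : V -> R) : R := \sum_(y <- nbrs x) srw_step R G x y * h y.

(** The expectation of phi(X_1, ..., X_t) for the simple random walk from x, as a finite sum that
    needs no probability space. *)
Fixpoint walk_sum t x phi : R :=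
  if t is t'.+1 then avg x (fun y => walk_sum t' y (fun s => phi (y :: s)))
  else phi [::].

Lemma mem_nbrs x y : (y \in nbrs x) = adj G x y.
Proof. by rewrite in_fset_set ?mem_setE //; exact: adj_fin. Qed.

Lemma srw_step_ge0 x y : 0 <= srw_step R G x y.
Proof. by rewrite /srw_step; case: ifP => // _; rewrite invr_ge0. Qed.

(** Only an inequality, because the total mass is 0 at an isolated vertex. *)
Lemma sum_srw_step x : \sum_(y <- nbrs x) srw_step R G x y <= 1.
Proof.
rewrite big_seq (eq_bigr (fun=> (deg G x)%:R^-1)); last first.
  by move=> y; rewrite mem_nbrs /srw_step => ->.
rewrite -big_seq big_const_seq count_predT iter_addr_0.
rewrite -[size _]/(deg G x); case: (deg G x) => [|n]; first by rewrite mulr0n.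
by rewrite -[leLHS]mulr_natl mulfV // pnatr_eq0.
Qed.

Lemma srw_step_le1 x y : srw_step R G x y <= 1.
Proof.
rewrite /srw_step; case: ifP => // _.
by case: (deg G x) => [|n]; rewrite ?invr0 // invf_le1 // ler1n.
Qed.

Lemma srw_prob_ge0 x s : 0 <= srw_prob R G x s.
Proof. by elim: s x => //= y s IH x; rewrite mulr_ge0 // srw_step_ge0. Qed.

Lemma srw_prob_cat x s s' :
  srw_prob R G x (s ++ s') = srw_prob R G x s * srw_prob R G (last x s) s'.
Proof. by elim: s x => [|y s IH] x /=; rewrite ?mul1r // IH mulrA. Qed.

Lemma ler_avg x h h' :
  (forall y, adj G x y -> h y <= h' y) -> avg x h <= avg x h'.
Proof.
move=> hh; rewrite /avg big_seq [leRHS]big_seq; apply: ler_sum => y.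
by rewrite mem_nbrs => xy; rewrite ler_wpM2l ?hh // srw_step_ge0.
Qed.

Lemma eq_avg x h h' : (forall y, adj G x y -> h y = h' y) -> avg x h = avg x h'.
Proof. by move=> hh; apply/eqP; rewrite eq_le !ler_avg // => y /hh ->. Qed.

Lemma avg_ge0 x h : (forall y, adj G x y -> 0 <= h y) -> 0 <= avg x h.
Proof.
move=> h0; have -> : 0 = avg x (fun=> 0).
  by rewrite /avg big1 // => y _; rewrite mulr0.
exact: ler_avg.
Qed.

Lemma avg_le x h c : 0 <= c -> (forall y, adj G x y -> h y <= c) -> avg x h <= c.
Proof.
move=> c0 hc; apply: (@le_trans _ _ (avg x (fun=> c))); first exact: ler_avg.
by rewrite /avg -mulr_suml ler_piMl // sum_srw_step.
Qed.

Lemma avgD x h h' : avg x (fun y => h y + h' y) = avg x h + avg x h'.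
Proof. by rewrite /avg -big_split; apply: eq_bigr => y _; rewrite mulrDr. Qed.

Lemma avgZ x c h : avg x (fun y => c * h y) = c * avg x h.
Proof. by rewrite /avg mulr_sumr; apply: eq_bigr => y _; rewrite mulrCA. Qed.

Lemma avg_sum (I : Type) (r : seq I) x (h : I -> V -> R) :
  avg x (fun y => \sum_(i <- r) h i y) = \sum_(i <- r) avg x (h i).
Proof. by rewrite /avg exchange_big; apply: eq_bigr => y _; rewrite mulr_sumr. Qed.

Lemma ler_walk_sum t x phi psi :
  (forall s, size s = t -> path (adj G) x s -> phi s <= psi s) ->
  walk_sum t x phi <= walk_sum t x psi.
Proof.
elim: t x phi psi => [|t IH] x phi psi le_phi /=; first exact: le_phi.
apply: ler_avg => y xy; apply: IH => s st ps.
by apply: le_phi; rewrite /= ?st ?xy.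
Qed.

Lemma eq_walk_sum t x phi psi :
  (forall s, size s = t -> path (adj G) x s -> phi s = psi s) ->
  walk_sum t x phi = walk_sum t x psi.
Proof.
by move=> e; apply/eqP; rewrite eq_le !ler_walk_sum // => s s1 s2; rewrite e.
Qed.

Lemma walk_sum_ge0 t x phi : (forall s, 0 <= phi s) -> 0 <= walk_sum t x phi.
Proof. by elim: t x phi => [|t IH] x phi phi0 //=; apply: avg_ge0 => y _; apply: IH. Qed.

Lemma walk_sum_le t x phi c : 0 <= c ->
  (forall s, size s = t -> path (adj G) x s -> phi s <= c) -> walk_sum t x phi <= c.
Proof.
move=> c0; elim: t x phi => [|t IH] x phi phic /=; first exact: phic.
apply: avg_le => // y xy; apply: IH => s st ps.
by apply: phic; rewrite /= ?st ?xy.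
Qed.

Lemma walk_sumZ t x c phi : walk_sum t x (fun s => c * phi s) = c * walk_sum t x phi.
Proof.
elim: t x phi => [|t IH] x phi //=.
by rewrite -avgZ; apply: eq_avg => y _; rewrite IH.
Qed.

Lemma walk_sumD t x phi psi :
  walk_sum t x (fun s => phi s + psi s) = walk_sum t x phi + walk_sum t x psi.
Proof.
elim: t x phi psi => [|t IH] x phi psi //=.
by rewrite -avgD; apply: eq_avg => y _; rewrite IH.
Qed.

Lemma walk_sum_sum (I : Type) (r : seq I) t x (phi : I -> seq V -> R) :
  walk_sum t x (fun s => \sum_(i <- r) phi i s) = \sum_(i <- r) walk_sum t x (phi i).
Proof.
elim: t x phi => [|t IH] x phi //=.
by rewrite -avg_sum; apply: eq_avg => y _; rewrite IH.
Qed.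

Lemma walk_sum_cat t u x phi :
  walk_sum (t + u) x phi =
  walk_sum t x (fun s => walk_sum u (last x s) (fun s' => phi (s ++ s'))).
Proof.
elim: t x phi => [|t IH] x phi //=.
by apply: eq_avg => y _; rewrite IH.
Qed.

Lemma walk_sum_eq w x :
  path (adj G) x w -> walk_sum (size w) x (fun s => (s == w)%:R) = srw_prob R G x w.
Proof.
elim: w x => [|v w IH] x //= /andP[xv pw].
rewrite /avg (bigD1_seq v) ?mem_nbrs ?fset_uniq //= big1 ?addr0.
  congr (_ * _); rewrite -IH //.
  by apply: eq_walk_sum => s _ _; rewrite eqseq_cons eqxx.
move=> y yv; rewrite (_ : walk_sum _ _ _ = 0) ?mulr0 //.
rewrite (@eq_walk_sum _ _ _ (fun=> 0 * 0)); first by rewrite walk_sumZ mul0r.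
by move=> s _ _; rewrite eqseq_cons (negbTE yv) mul0r.
Qed.

Lemma srw_prob_path x w : 0 < srw_prob R G x w -> path (adj G) x w.
Proof.
elim: w x => [|y w IH] x //=; rewrite /srw_step.
case: ifP => [_|_]; last by rewrite mul0r ltxx.
move=> h; rewrite IH // lt_neqAle srw_prob_ge0 andbT eq_sym.
by apply: contraTneq h => ->; rewrite mulr0 ltxx.
Qed.

Lemma walk_sum_word_le w x phi b theta :
  0 < b -> b <= srw_prob R G x w -> theta <= 1 -> (forall s, phi s <= 1) -> phi w <= theta ->
  walk_sum (size w) x phi <= 1 - b * (1 - theta).
Proof.
move=> b0 bw t1 phi1 phiw.
have pw : path (adj G) x w by apply: srw_prob_path; exact: lt_le_trans bw.
apply: (@le_trans _ _ (1 - srw_prob R G x w * (1 - theta))); last first.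
  by rewrite lerD2l lerN2 ler_wpM2r // subr_ge0.
(* Adding 1 - theta times the indicator of w to [phi] keeps it at most 1. *)
rewrite lerBrDr -walk_sum_eq // mulrC -walk_sumZ -walk_sumD.
apply: walk_sum_le => // s _ _; case: eqP => [->|_].
  by rewrite mulr1; lra.
by rewrite mulr0 addr0.
Qed.

(** Detailed balance, step by step. The induction removes the first step of the walk from y, which
    is the last step of the reversed walk from z. *)
Lemma walk_sum_rev t y z phi : (0 < deg G y)%N -> (0 < deg G z)%N ->
  (deg G y)%:R * walk_sum t y (fun s => (last y s == z)%:R * phi (y :: s)) =
  (deg G z)%:R * walk_sum t z (fun s => (last z s == y)%:R * phi (rev (z :: s))).
Proof.
move=> + dz; elim: t y phi => [|t IH] y phi dy.
  rewrite /= [z == y]eq_sym; case: eqP => [->|_]; first by rewrite !mul1r.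
  by rewrite !mul0r !mulr0.
have ny : (deg G y)%:R != 0 :> R by rewrite pnatr_eq0 -lt0n.
rewrite -[in RHS]addn1 walk_sum_cat /=.
transitivity (\sum_(u <- nbrs y)
    (deg G z)%:R * walk_sum t z (fun s => (last z s == u)%:R *
      ((deg G u)%:R^-1 * phi (y :: rev (z :: s))))).
  rewrite /avg mulr_sumr !big_seq; apply: eq_bigr => u; rewrite mem_nbrs => yu.
  have du : (0 < deg G u)%N.
    rewrite /deg cardfs_gt0; apply/fset0Pn; exists y.
    by rewrite -[_ \in _]/(y \in nbrs u) mem_nbrs adj_sym.
  have nu : (deg G u)%:R != 0 :> R by rewrite pnatr_eq0 -lt0n.
  rewrite /srw_step yu mulrA mulfV // mul1r.
  (* The factor 1 / deg u is moved into [phi], so that the induction hypothesis applies from u with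
     its weight deg u. *)
  have := IH u (fun s => (deg G u)%:R^-1 * phi (y :: s)) du.
  under eq_walk_sum => s _ _ do rewrite mulrCA.
  by rewrite walk_sumZ mulrA mulfV // mul1r => ->.
rewrite -mulr_sumr -walk_sum_sum; congr (_ * _); apply: eq_walk_sum => s _ _.
under eq_bigr do rewrite mulrA.
rewrite -mulr_suml /avg.
case: (boolP (adj G (last z s) y)) => ay; last first.
  rewrite !big_seq !big1 ?mul0r // => u; rewrite mem_nbrs => au; last first.
    by case: eqP => [e|]; rewrite ?mul0r //; move: ay; rewrite e adj_sym au.
  rewrite last_cat /=; case: eqP => [e|]; rewrite ?mul0r ?mulr0 //.
  by move: au; rewrite e (negbTE ay).
rewrite (bigD1_seq (last z s)) ?fset_uniq ?mem_nbrs //=; last by rewrite adj_sym.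
rewrite eqxx big1 ?addr0; last by move=> u; rewrite eq_sym => /negbTE ->; rewrite mul0r.
rewrite (bigD1_seq y) ?fset_uniq ?mem_nbrs //= big1 ?addr0; last first.
  by move=> u uy; rewrite last_cat /= (negbTE uy) mul0r mulr0.
by rewrite last_cat /= eqxx /srw_step ay !mul1r cats1 -rcons_cons rev_rcons.
Qed.

End WalkSums.

(** * Visits and survival of a walk killed with submultiplicative weights *)

Section KilledWalk.
Variables (R : realType) (V : choiceType) (G : lfgraph V).
Implicit Types (x y z v : V) (s w : seq V) (t l n N : nat) (S B : {fset V}).

Variable om : seq V -> R.
Hypothesis om_ge0 : forall s, 0 <= om s.
Hypothesis om_le1 : forall s, om s <= 1.
Hypothesis om_cat : forall s s', om (s ++ s') <= om s * om s'.
Variables (delta : R) (L : nat).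
Hypothesis delta01 : 0 < delta <= 1.

(* om s is the probability of surviving the steps s: from v, the walk is killed
   with probability at least delta within L steps. *)
Definition killing v :=
  exists l, [/\ (0 < l)%N, (l <= L)%N & walk_sum G l v om <= 1 - delta].

Let d0 : 0 < delta. Proof. by case/andP: delta01. Qed.
Let d1 : 0 <= 1 - delta. Proof. by case/andP: delta01 => _ h; rewrite subr_ge0. Qed.

Let om_catr s s' : om (s ++ s') <= om s'.
Proof. by apply: (le_trans (om_cat s s')); rewrite ler_piMl. Qed.

Let om_catl s s' : om (s ++ s') <= om s.
Proof. by apply: (le_trans (om_cat s s')); rewrite ler_piMr. Qed.

(** Truncated Green function: the expected number of visits to S of the killed walk at times 0 to N
    - 1. *)
Definition green S N x : R :=
  \sum_(t < N) walk_sum G t x (fun s => (last x s \in S)%:R * om s).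

Let term_ge0 S x s : 0 <= (last x s \in S)%:R * om s.
Proof. by rewrite mulr_ge0. Qed.

Let term_le1 S x s : (last x s \in S)%:R * om s <= 1.
Proof. by rewrite mulr_ile1 ?ler0n // lern1 leq_b1. Qed.

Lemma green_le S N x : green S N x <= N%:R.
Proof.
rewrite -[N in leRHS]card_ord -sum1_card natr_sum.
by apply: ler_sum => t _; apply: walk_sum_le.
Qed.

Lemma green_nondecreasing S l N x : (l <= N)%N -> green S l x <= green S N x.
Proof.
move=> lN; rewrite /green -(subnKC lN) big_split_ord /= lerDl.
by apply: sumr_ge0 => t _; exact: walk_sum_ge0.
Qed.

Lemma green_eq0 S l x :
  (forall s, (size s < l)%N -> path (adj G) x s -> last x s \notin S) ->
  green S l x = 0.
Proof.
move=> h; apply: big1 => -[t /= tl] _.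
apply/eqP; rewrite eq_le walk_sum_ge0 // andbT walk_sum_le // => s st ps.
by rewrite (negbTE (h _ _ ps)) ?mul0r // st.
Qed.

Lemma green_step S N x : green S N.+1 x <= (x \in S)%:R + avg G x (green S N).
Proof.
rewrite /green big_ord_recl /= lerD //; first by rewrite ler_piMr ?ler0n.
rewrite avg_sum; apply: ler_sum => t _; apply: ler_avg => y _.
apply: ler_walk_sum => s _ _ /=; rewrite ler_wpM2l ?ler0n //.
exact: (om_catr [:: y]).
Qed.

(** Visits during the first l steps are kept as they are. Later ones are bounded by c times the mass
    surviving these steps, since the weight of a concatenation is at most the product. *)
Lemma green_window S l N x c : 0 <= c -> walk_sum G l x om <= 1 - delta ->
  (forall s, size s = l -> path (adj G) x s -> green S N (last x s) <= c) ->
  green S (l + N) x <= green S l x + (1 - delta) * c.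
Proof.
move=> c0 kl gc; rewrite /green big_split_ord lerD2l /=.
apply: (@le_trans _ _ (walk_sum G l x (fun s => c * om s))); last first.
  by rewrite walk_sumZ mulrC ler_wpM2r.
apply: (@le_trans _ _ (walk_sum G l x (fun s => \sum_(t < N) om s *
    walk_sum G t (last x s) (fun s' => (last (last x s) s' \in S)%:R * om s')))).
  rewrite walk_sum_sum; apply: ler_sum => t _; rewrite walk_sum_cat.
  apply: ler_walk_sum => s _ _; rewrite -walk_sumZ.
  apply: ler_walk_sum => s' _ _; rewrite last_cat mulrCA.
  by rewrite ler_wpM2l ?ler0n.
apply: ler_walk_sum => s ss ps; rewrite -mulr_sumr mulrC.
by rewrite ler_wpM2r // gc.
Qed.

(** The bound is the fixed point of a = L + (1 - delta) a: from a vertex of S, at most L visits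
    occur in a killing window, and a mass at most 1 - delta survives it. Outside S one step is
    averaged without gaining a visit. *)
Lemma green_bound S : (forall v, v \in S -> killing v) ->
  forall N x, green S N x <= L%:R / delta.
Proof.
move=> kS; have a0 : 0 <= L%:R / delta by rewrite divr_ge0 ?ler0n // ltW.
elim/ltn_ind=> -[|N] IH x; first by rewrite /green big_ord0.
have [xS|xS] := boolP (x \in S); last first.
  apply: (le_trans (green_step _ _ _)); rewrite (negbTE xS) add0r.
  by apply: avg_le => // y _; exact: IH.
have [l [l0 lL kl]] := kS x xS.
have gl : green S l x <= L%:R by apply: (le_trans (green_le _ _ _)); rewrite ler_nat.
have La : L%:R + (1 - delta) * (L%:R / delta) = L%:R / delta.
  by field; rewrite gt_eqF.
have [lN|Nl] := leqP l N.+1; last first.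
  apply: (le_trans (green_nondecreasing _ _ (ltnW Nl))).
  by apply: (le_trans gl); rewrite -La lerDl mulr_ge0.
rewrite -(subnKC lN); apply: (le_trans (green_window a0 kl _)); last first.
  by rewrite -[leRHS]La lerD2r.
by move=> s _ _; apply: IH; rewrite ltn_subrL l0.
Qed.

Lemma reachable_bound (r : seq V) l : exists r' : seq V,
  forall x s, x \in r -> path (adj G) x s -> (size s <= l)%N -> last x s \in r'.
Proof.
elim: l r => [|l IH] r.
  by exists r => x [|y s].
have [r' r'P] := IH (flatten [seq nbrs G x | x <- r]).
exists (r ++ r') => x [|y s] /=; first by rewrite mem_cat => ->.
move=> xr /andP[xy ps] sl; rewrite mem_cat (r'P y) ?orbT //.
by apply/flatten_mapP; exists x => //; rewrite mem_nbrs.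
Qed.

Section Exhaustion.
Variable B : nat -> {fset V}.
Hypothesis B_incr : forall n, (0 < n)%N -> (B n `<=` B n.+1)%fset.
Hypothesis B_exh : forall y, exists2 n, (0 < n)%N & y \in B n.
Hypothesis B_killing : forall n v, (0 < n)%N -> v \in bdry G (B n) -> killing v.

Let B_homo m n : (0 < m)%N -> (m <= n)%N -> (B m `<=` B n)%fset.
Proof.
move=> m0 /subnKC <-; elim: (n - m)%N => [|k IH]; first by rewrite addn0.
apply: (fsubset_trans IH); rewrite addnS; apply: B_incr.
exact: leq_trans (leq_addr _ _).
Qed.

Lemma exhaustion_cover (K : seq V) : exists m, (0 < m)%N /\
  forall n x, (m <= n)%N -> x \in K -> x \in B n.
Proof.
elim: K => [|y K [m [m0 IH]]]; first by exists 1%N.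
have [k k0 yk] := B_exh y.
exists (maxn m k); rewrite leq_max m0; split=> // n x; rewrite geq_max.
move=> /andP[mn kn]; rewrite inE => /orP[/eqP->|]; last exact: IH.
exact: (fsubsetP (B_homo k0 kn)).
Qed.

(** Uniformity over each finite set of starting points is what can be iterated: an improvement on K
    relies on the estimate on a larger finite set. *)
Definition green_limit_le (eta : R) := forall K : seq V, exists n0,
  forall n N x, (n0 <= n)%N -> x \in K -> green (bdry G (B n)) N x <= eta.

Lemma notin_bdry S v : (forall u, adj G v u -> u \in S) -> v \notin bdry G S.
Proof.
by move=> h; rewrite !inE negb_and; apply/orP; right; apply/asboolPn => -[u /h ->].
Qed.

(* To reach the boundary of B n, the walk has to cross that of a smaller B m,
   where it is killed with probability delta. *)
Lemma green_limit_step eta :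
  0 <= eta -> green_limit_le eta -> green_limit_le ((1 - delta) * eta).
Proof.
move=> e0 good K; have [m [m0 KB]] := exhaustion_cover K.
(* One step more than the length of a window: a vertex reached within L steps is off the boundary of
   B n as soon as its neighbours lie in B n. *)
have [K' K'P] := reachable_bound (B m) L.+1.
have [n0 n0P] := good K'; have [n1 [_ n1P]] := exhaustion_cover K'.
exists (maxn n0 n1) => n N x; rewrite geq_max => /andP[n0n n1n] /(KB m _ (leqnn m)) xB.
have miss y s : y \in B m -> path (adj G) y s -> (size s <= L)%N ->
    last y s \notin bdry G (B n).
  move=> yB ps sL; apply: notin_bdry => u au; apply: n1P => //.
  rewrite -(last_rcons y s u); apply: K'P => //; last by rewrite size_rcons.
  by rewrite rcons_path ps.
elim/ltn_ind: N x xB => -[|N] IH x xB.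
  by rewrite /green big_ord0 mulr_ge0.
have [/(B_killing m0)[l [l0 lL kl]]|nb] := boolP (x \in bdry G (B m)).
  have gl : green (bdry G (B n)) l x = 0.
    apply: green_eq0 => s sl ps; apply: miss => //.
    exact: leq_trans (ltnW sl) lL.
  have [lN|Nl] := leqP l N.+1; last first.
    apply: (le_trans (green_nondecreasing _ _ (ltnW Nl))).
    by rewrite gl mulr_ge0.
  rewrite -(subnKC lN); apply: (le_trans (green_window e0 kl _)); last first.
    by rewrite gl add0r.
  move=> s sl ps; apply: n0P => //; apply: K'P => //.
  by rewrite sl leqW.
apply: (le_trans (green_step _ _ _)).
rewrite (negbTE (miss x [::] xB _ _)) // add0r; apply: avg_le; first exact: mulr_ge0.
(* A vertex of B m off its boundary has all its neighbours in B m. *)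
move=> y xy; apply: IH => //; apply: contraR nb => yB; rewrite !inE xB /=.
by apply/asboolP; exists y.
Qed.

Lemma geometric_le_eps (a e : R) : 0 <= a -> 0 < e ->
  exists k, (1 - delta) ^+ k * a <= e.
Proof.
move=> a0 e0.
have h : (fun k => (1 - delta) ^+ k * a) @ \oo --> (0 : R).
  rewrite -[0](mul0r a); apply: cvgM; last exact: cvg_cst.
  by apply: cvg_expr; rewrite ger0_norm // gtrBl.
move/cvgrPdist_le : h => /(_ e e0)[k _ kP].
exists k; have := kP k (leqnn k); rewrite /= sub0r normrN.
exact: le_trans (ler_norm _).
Qed.

(** Starting from the bound L / delta, each application of [green_limit_step] gains a factor 1 -
    delta. *)
Lemma green_small x e : 0 < e ->
  exists2 n, (0 < n)%N & forall N, green (bdry G (B n)) N x <= e.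
Proof.
move=> e0; have a0 : 0 <= L%:R / delta by rewrite divr_ge0 ?ler0n // ltW.
have good k : green_limit_le ((1 - delta) ^+ k * (L%:R / delta)).
  elim: k => [|k IH].
    move=> K; exists 1%N => n N y n0 _; rewrite expr0 mul1r.
    by apply: green_bound => v; exact: B_killing.
  by rewrite exprS -mulrA; apply: green_limit_step => //; rewrite mulr_ge0 // exprn_ge0.
have [k ke] := geometric_le_eps a0 e0; have [n0 n0P] := good k [:: x].
exists n0.+1 => // N; apply: le_trans ke; apply: n0P; last by rewrite inE.
exact: leqnSn.
Qed.

End Exhaustion.

(** * The killed walk dies almost surely *)

Section Termination.
Hypothesis V_infinite : infinite_set [set: V].
Hypothesis G_connected : connected_graph G.
Hypothesis ball : forall x, exists B, x \in B /\ forall v, v \in bdry G B -> killing v.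

Let surv t x := walk_sum G t x om.

Let surv_step t x : surv t.+1 x <= avg G x (surv t).
Proof.
by apply: ler_avg => y _; apply: ler_walk_sum => s _ _; exact: (om_catr [:: y]).
Qed.

Let surv_noninc x : nonincreasing_seq (surv ^~ x).
Proof.
apply/nonincreasing_seqP => t; rewrite /surv -addn1 walk_sum_cat.
apply: ler_walk_sum => s _ _; apply: avg_le => // y _ /=; exact: om_catl.
Qed.

(** The mass surviving forever from x, a subharmonic function. *)
Let slim x : R := limn (surv ^~ x).

Let surv_cvg x : surv ^~ x @ \oo --> slim x.
Proof.
apply: nonincreasing_is_cvgn => //; exists 0 => _ [t _ <-].
exact: walk_sum_ge0.
Qed.

Lemma cvg_avg x (h : nat -> V -> R) h' :
  (forall y, h ^~ y @ \oo --> h' y) -> avg G x (h n) @[n --> \oo] --> avg G x h'.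
Proof.
move=> hh; rewrite /avg; elim: (nbrs G x) => [|y r IH].
  under eq_fun do rewrite big_nil; rewrite big_nil; exact: cvg_cst.
under eq_fun do rewrite big_cons; rewrite big_cons.
by apply: cvgD => //; apply: cvgM => //; exact: cvg_cst.
Qed.

Lemma cvg_walk_sum l x (h : nat -> seq V -> R) h' :
  (forall s, h ^~ s @ \oo --> h' s) ->
  walk_sum G l x (h n) @[n --> \oo] --> walk_sum G l x h'.
Proof.
elim: l x h h' => [|l IH] x h h' hh /=; first exact: hh.
by apply: cvg_avg => y; apply: IH => s; exact: hh.
Qed.

Let slim_ge0 x : 0 <= slim x.
Proof.
apply: limr_ge; first by apply/cvg_ex; exists (slim x); exact: surv_cvg.
by near=> t; exact: walk_sum_ge0.
Unshelve. all: by end_near.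
Qed.

Let slim_le1 x : slim x <= 1.
Proof.
apply: limr_le; first by apply/cvg_ex; exists (slim x); exact: surv_cvg.
by near=> t; apply: walk_sum_le.
Unshelve. all: by end_near.
Qed.

Let slim_avg x : slim x <= avg G x slim.
Proof.
have h1 : surv n.+1 x @[n --> \oo] --> slim x.
  by rewrite (cvg_shiftS (surv ^~ x)); exact: surv_cvg.
have h2 : avg G x (surv n) @[n --> \oo] --> avg G x slim by exact: cvg_avg.
apply: ler_cvg_to h1 h2 _; near=> n; exact: surv_step.
Unshelve. all: by end_near.
Qed.

Let slim_killing eta v : 0 <= eta -> (forall x, slim x <= eta) -> killing v ->
  slim v <= (1 - delta) * eta.
Proof.
move=> e0 he [l [l0 lL kl]].
have h1 : surv (n + l)%N v @[n --> \oo] --> slim v.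
  by rewrite (cvg_shiftn l (surv ^~ v)); exact: surv_cvg.
have h2 : walk_sum G l v (fun s => om s * surv n (last v s)) @[n --> \oo] -->
    walk_sum G l v (fun s => om s * slim (last v s)).
  apply: cvg_walk_sum => s; apply: cvgM; first exact: cvg_cst.
  exact: surv_cvg.
apply: (@le_trans _ _ (walk_sum G l v (fun s => om s * slim (last v s)))).
  apply: ler_cvg_to h1 h2 _; near=> n; rewrite addnC /surv walk_sum_cat.
  apply: ler_walk_sum => s _ _; rewrite -walk_sumZ.
  by apply: ler_walk_sum => s' _ _; exact: om_cat.
apply: (@le_trans _ _ (walk_sum G l v (fun s => eta * om s))).
  by apply: ler_walk_sum => s _ _; rewrite mulrC ler_wpM2r.
by rewrite walk_sumZ mulrC ler_wpM2r.
Unshelve. all: by end_near.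
Qed.

Lemma avg_lt x (h : V -> R) u c : 0 <= c -> (forall y, adj G x y -> h y <= c) ->
  adj G x u -> h u < c -> avg G x h < c.
Proof.
move=> c0 hc xu uc.
have st : 0 < srw_step R G x u.
  rewrite /srw_step xu invr_gt0 ltr0n /deg cardfs_gt0; apply/fset0Pn.
  by exists u; rewrite -[_ \in _]/(u \in nbrs G x) mem_nbrs.
(* Raising h by its deficit at u keeps it below c, and the average then increases strictly. *)
have: avg G x (fun y => h y + (y == u)%:R * (c - h u)) <= c.
  apply: avg_le => // y xy; case: eqP => [->|_]; first by rewrite mul1r; lra.
  by rewrite mul0r addr0 hc.
rewrite avgD; apply: lt_le_trans; rewrite ltrDl /avg.
rewrite (bigD1_seq u) ?mem_nbrs ?fset_uniq //= eqxx mul1r big1 ?addr0.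
  by rewrite mulr_gt0 // subr_gt0.
by move=> y /negbTE ->; rewrite mul0r mulr0.
Qed.

Lemma exists_max_seq (r : seq V) (h : V -> R) : r != [::] ->
  exists2 x, x \in r & forall y, y \in r -> h y <= h x.
Proof.
elim: r => // x [|y r] IH _.
  by exists x; rewrite ?mem_head // => y; rewrite inE => /eqP->.
have [z zr zP] := IH isT; have [xz|zx] := leP (h x) (h z).
  exists z; first by rewrite inE zr orbT.
  by move=> u; rewrite inE => /orP[/eqP->|/zP].
exists x; first by rewrite mem_head.
move=> u; rewrite inE => /orP[/eqP->//|/zP h1].
exact: le_trans h1 (ltW zx).
Qed.

(* Maximum principle for the subharmonic function slim. *)
Let slim_max B c x : x \in B -> (forall v, v \in bdry G B -> slim v <= c) -> slim x <= c.
Proof.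
move=> xB hc.
have [xm xmB xmP] : exists2 x, x \in B & forall y, y \in B -> slim y <= slim x.
  by apply: exists_max_seq; apply/eqP => B0; move: xB; rewrite -[_ \in _]/(x \in enum_fset B) B0.
apply: (le_trans (xmP _ xB)); rewrite leNgt; apply/negP => cm.
(* V is infinite, so some path leaves B. A maximum above c would be attained off the boundary and
   would spread to all neighbours, hence along this path without ever leaving B. *)
have [y yB] : exists y, y \notin B.
  apply: contrapT => h; apply: V_infinite; apply: (sub_finite_set _ (finite_fset B)).
  by move=> y _ /=; apply: contrapT => /negP yB; apply: h; exists y.
have [s ps ls] := G_connected xm y.
have: forall u, u \in B -> slim u = slim xm -> path (adj G) u s -> last u s \in B.
  elim: s {ps ls} => [|u' s IH] u uB um //= /andP[uu' ps].
  have ub : u \notin bdry G B.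
    by apply: contraL cm => /hc; rewrite um -leNgt.
  have nB v : adj G u v -> v \in B.
    move=> uv; apply: contraR ub => vB; rewrite !inE uB /=.
    by apply/asboolP; exists v.
  apply: IH => //; first exact: nB.
  apply/eqP; rewrite eq_le xmP ?nB //= leNgt; apply/negP => lt.
  have := slim_avg u; rewrite um leNgt => /negP; apply.
  by apply: (avg_lt _ _ uu') => // v /nB; exact: xmP.
by move=> /(_ xm xmB erefl ps); rewrite ls (negbTE yB).
Qed.

(** If eta bounds [slim] everywhere, then (1 - delta) eta bounds it at killing vertices, so on the
    boundary of a finite set around x, so at x by the maximum principle. Iterating from the bound 1
    gives 0. *)
Lemma surv_cvg0 x : walk_sum G t x om @[t --> \oo] --> (0 : R).
Proof.
have h k : forall x, slim x <= (1 - delta) ^+ k * 1.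
  elim: k => [|k IH] y; first by rewrite mul1r.
  have [B [yB kB]] := ball y; apply: (slim_max yB) => v vB.
  by rewrite exprS -mulrA; apply: slim_killing (kB _ vB) => //; rewrite mulr1 exprn_ge0.
suff <- : slim x = 0 by exact: surv_cvg.
apply/eqP; rewrite eq_le slim_ge0 andbT; apply/ler_addgt0Pr => e e0.
have [k ke] := geometric_le_eps ler01 e0.
by rewrite add0r (le_trans (h k x)).
Qed.

End Termination.
End KilledWalk.
(** * Loops kept by the loop-erased walk *)

Section Alive.
Variables (R : realType) (V : choiceType) (G : lfgraph V) (p : ocycle G -> R).
Hypothesis p01 : forall c, 0 <= p c <= 1.
Implicit Types (x y z v : V) (s w P : seq V).

Lemma loop_weight01 s : 0 <= loop_weight p s <= 1.
Proof. by rewrite /loop_weight; case: pselect => [?|_]; rewrite ?p01 // lexx ler01. Qed.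

Lemma loop_weight_ge0 s : 0 <= loop_weight p s.
Proof. by case/andP: (loop_weight01 s). Qed.

Lemma loop_weight_le1 s : 0 <= 1 - loop_weight p s.
Proof. by case/andP: (loop_weight01 s) => _; rewrite subr_ge0. Qed.

Lemma rotations_rot k s : rotations (rot k s) = rotations s.
Proof.
have sub m r : rotations (rot m r) `<=` rotations r.
  move=> _ [i _ <-]; have [mr|/ltnW mr] := leqP m (size r); last first.
    by rewrite (rot_oversize mr); exists i.
  have [ir|/ltnW ir] := leqP i (size r); last first.
    by rewrite (@rot_oversize _ i) ?size_rot //; exists m.
  by rewrite rot_add_mod //; eexists.
apply/seteqP; split; first exact: sub.
by rewrite -{1}(rotK k s) /rotr; exact: sub.
Qed.

Lemma is_cycle_rot k s : is_cycle G (rot k s) = is_cycle G s.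
Proof. by rewrite /is_cycle size_rot rot_uniq rot_cycle. Qed.

Lemma ocycle_inj (c c' : ocycle G) : sval c = sval c' -> c = c'.
Proof. by case: c c' => [c h] [c' h'] /= e; subst c'; congr exist; exact: Prop_irrelevance. Qed.

Lemma loop_weight_rot k s : loop_weight p (rot k s) = loop_weight p s.
Proof.
rewrite /loop_weight; case: pselect => [h|h]; case: pselect => [h'|h'] //.
- by congr p; apply: ocycle_inj; exact: rotations_rot.
- by case: h'; rewrite -(is_cycle_rot k).
- by case: h; rewrite is_cycle_rot.
Qed.

Lemma represents_cycle s (c : ocycle G) : represents s c -> is_cycle G s.
Proof.
by case: c => c [s' cs' e]; rewrite /represents /= e => -[k _ <-]; rewrite is_cycle_rot.
Qed.

Lemma loop_weight_represents s (c : ocycle G) : represents s c -> loop_weight p s = p c.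
Proof.
move=> sc; rewrite /loop_weight; case: pselect => [h|[]]; last exact: represents_cycle sc.
congr p; apply: ocycle_inj => /=; case: c sc => c [s' cs' e].
by rewrite /represents /= e => -[k _ <-]; rewrite rotations_rot.
Qed.

(* Probability that none of the loops closed while reading s, from the current
   path P, is kept. *)
Fixpoint alive P s : R :=
  if s is v :: s' then
    if v \notin P then alive (rcons P v) s'
    else (1 - loop_weight p (drop (index v P) P)) * alive (take (index v P).+1 P) s'
  else 1.

Fixpoint erased P s : seq V :=
  if s is v :: s' then
    erased (if v \notin P then rcons P v else take (index v P).+1 P) s'
  else P.

Lemma alive_cat P s s' : alive P (s ++ s') = alive P s * alive (erased P s) s'.
Proof.
elim: s P => [|v s IH] P /=; first by rewrite mul1r.
by case: ifP => _; rewrite IH // mulrA.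
Qed.

Lemma alive01 P s : 0 <= alive P s <= 1.
Proof.
elim: s P => [|v s IH] P /=; first by rewrite ler01 lexx.
case: ifP => // _; have /andP[a0 a1] := IH (take (index v P).+1 P).
by rewrite mulr_ge0 ?mulr_ile1 ?loop_weight_le1 // gerBl loop_weight_ge0.
Qed.

Lemma alive_ge0 P s : 0 <= alive P s. Proof. by case/andP: (alive01 P s). Qed.
Lemma alive_le1 P s : alive P s <= 1. Proof. by case/andP: (alive01 P s). Qed.

(** The worst case over current paths. It forgets the past, and so can play the role of [om] for the
    killed walk. *)
Definition alive_sup s : R := sup (range (alive ^~ s)).

Let alive_has_sup s : has_sup (range (alive ^~ s)).
Proof.
split; first by exists (alive [::] s), [::].
by exists 1 => _ [P _ <-]; exact: alive_le1.
Qed.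

Lemma alive_le_sup P s : alive P s <= alive_sup s.
Proof. by apply: ub_le_sup; [exact: (alive_has_sup s).2|exists P]. Qed.

Lemma alive_sup_le s c : (forall P, alive P s <= c) -> alive_sup s <= c.
Proof.
by move=> h; apply: ge_sup; [exact: (alive_has_sup s).1|move=> _ [P _ <-]].
Qed.

Lemma alive_sup_ge0 s : 0 <= alive_sup s.
Proof. exact: le_trans (alive_ge0 [::] s) (alive_le_sup _ _). Qed.

Lemma alive_sup_le1 s : alive_sup s <= 1.
Proof. by apply: alive_sup_le => P; exact: alive_le1. Qed.

Lemma alive_sup_cat s s' : alive_sup (s ++ s') <= alive_sup s * alive_sup s'.
Proof.
apply: alive_sup_le => P; rewrite alive_cat.
by rewrite ler_pM ?alive_ge0 ?alive_le_sup.
Qed.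

Lemma alive_fresh P s s' : uniq s -> ~~ has (mem P) s ->
  alive P (s ++ s') = alive (P ++ s) s'.
Proof.
elim: s P => [|v s IH] P /=; first by rewrite cats0.
move=> /andP[vs us]; rewrite negb_or => /andP[vP sP].
rewrite vP IH // ?cat_rcons //; apply/hasPn => x xs /=.
rewrite mem_rcons inE negb_or (hasPn sP) // andbT.
by apply: contraNneq vs => <-.
Qed.

Lemma take_index_cat P0 x P1 : x \notin P0 ->
  take (index x (P0 ++ x :: P1)).+1 (P0 ++ x :: P1) = rcons P0 x.
Proof.
move=> xP0; rewrite index_cat (negbTE xP0) /= eqxx addn0 take_cat.
by rewrite ltnNge leqnSn /= subSnn /= take0 cats1.
Qed.

Lemma drop_index_cat P0 x P1 : x \notin P0 ->
  drop (index x (P0 ++ x :: P1)) (P0 ++ x :: P1) = x :: P1.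
Proof.
by move=> xP0; rewrite index_cat (negbTE xP0) /= eqxx addn0 drop_size_cat.
Qed.

(** P0 contains no vertex of c, so reading letters of c cuts the path only behind P0 and never
    removes x. *)
Lemma erased_keep (c : seq V) P0 x P1 s : ~~ has (mem c) P0 -> {subset s <= c} ->
  exists P2, erased (P0 ++ x :: P1) s = P0 ++ x :: P2.
Proof.
move=> cP0; elim: s P1 => [|v s IH] P1 sc /=; first by exists P1.
have {}IH P := IH P (fun y ys => sc y (mem_behead (s := v :: s) ys)).
have vc : v \in c by apply: sc; exact: mem_head.
have vP0 : v \notin P0 by apply: contraL vc => vP0; exact: (hasPn cP0).
case: ifP => _; first by rewrite rcons_cat rcons_cons; exact: IH.
rewrite take_cat index_cat (negbTE vP0) ltnNge leqW ?leq_addr //=.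
by rewrite -addnS addKn /=; exact: IH.
Qed.

(** The path avoids the cycle, which is thus appended whole; returning to x then closes exactly this
    loop. *)
Lemma alive_close P0 (x : V) c s : uniq (x :: c) -> ~~ has (mem (x :: c)) P0 ->
  alive P0 (x :: c ++ x :: s) <= 1 - loop_weight p (x :: c).
Proof.
move=> uc cP; rewrite -cat_cons alive_fresh //; last by rewrite has_sym.
have xP : x \notin P0 by apply/negP => /(hasPn cP); rewrite /= inE eqxx.
rewrite /= mem_cat mem_head orbT /= drop_index_cat //.
by rewrite ler_piMr ?loop_weight_le1 // alive_le1.
Qed.

(* Going twice around a cycle closes it as a loop, whatever the current path is. *)
Lemma alive_double_loop x c : uniq (x :: c) ->
  alive_sup ((x :: c) ++ (x :: c) ++ [:: x]) <= 1 - loop_weight p (x :: c).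
Proof.
move=> uc; apply: alive_sup_le => P.
have [hP|hP] := boolP (has (mem (x :: c)) P); last exact: alive_close.
move: uc hP; move: (x :: c) => C uc hP.
(* y is the first vertex of the path on the cycle. When the first turn reaches y, the path is cut
   back to P0 followed by y; the next full turn, started at y, closes a rotation of C. *)
case: (split_find hP) => y P0 P1 /= yc cP0.
have [c1 [c2 e]] : exists c1 c2, C = c1 ++ y :: c2.
  by case/splitPr: yc => c1 c2; exists c1, c2.
have -> : C ++ C ++ [:: x] = c1 ++ y :: (c2 ++ c1) ++ y :: c2 ++ [:: x].
  by rewrite e /= -!catA.
have yP0 : y \notin P0 by apply/negP => /(hasPn cP0); rewrite /= yc.
rewrite alive_cat (le_trans (ler_piMl (alive_ge0 _ _) (alive_le1 _ _))) //.
rewrite cat_rcons.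
have c1C : {subset c1 <= C} by move=> z zc; rewrite e mem_cat zc.
have [P2 ->] := erased_keep y P1 cP0 c1C.
rewrite [leLHS]/= mem_cat mem_head orbT /= take_index_cat //.
rewrite (le_trans (ler_piMl (alive_ge0 _ _) _)) ?gerBl ?loop_weight_ge0 //.
have eC : y :: c2 ++ c1 = rot (size c1) C by rewrite e rot_size_cat.
rewrite -[leRHS](_ : 1 - loop_weight p (y :: c2 ++ c1) = _); last first.
  by rewrite eC loop_weight_rot.
have uC : uniq (y :: c2 ++ c1) by rewrite eC rot_uniq.
have cP : ~~ has (mem (y :: c2 ++ c1)) P0.
  by rewrite eC; apply/hasPn => z /(hasPn cP0) /=; rewrite mem_rot.
have := alive_close (c2 ++ [:: x]) uC cP.
by rewrite [in X in X -> _]/= yP0.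
Qed.

Lemma srw_prob_rev x s :
  (deg G x)%:R * srw_prob R G x s =
  (deg G (last x s))%:R * srw_prob R G (last x s) (rev (belast x s)).
Proof.
elim: s x => [|y s IH] x //=.
rewrite rev_cons -cats1 srw_prob_cat [RHS]mulrA -IH /= mulr1.
have -> : last (last y s) (rev (belast y s)) = y.
  by case: s {IH} => //= u s; rewrite rev_cons last_rcons.
rewrite /srw_step [adj G y x]adj_sym; case: ifP => xy; last by rewrite !(mul0r, mulr0).
rewrite [LHS]mulrA mulfV ?mul1r; last first.
  rewrite pnatr_eq0 -lt0n /deg cardfs_gt0; apply/fset0Pn; exists y.
  by rewrite -[_ \in _]/(y \in nbrs G x) mem_nbrs.
rewrite mulrAC mulfV ?mul1r // pnatr_eq0 -lt0n /deg cardfs_gt0.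
by apply/fset0Pn; exists x; rewrite -[_ \in _]/(x \in nbrs G y) mem_nbrs adj_sym.
Qed.

(** The two neighbours of x along the cycle are distinct, because a cycle has more than two
    vertices. *)
Lemma cycle_deg s x : is_cycle G s -> x \in s -> (1 < deg G x)%N.
Proof.
move=> cs /rot_to[i s' e]; move: cs; rewrite -(is_cycle_rot i) e.
case: s' {e} => [|y [|z s']] //; rewrite /is_cycle => /and3P[_].
move=> /and3P[_ yz _] /= /and3P[xy _]; rewrite rcons_path => /andP[_ zx].
apply: (@uniq_leq_size _ [:: y; last z s'] (nbrs G x)).
  by rewrite /= andbT inE; apply: contraNneq yz => ->; exact: mem_last.
move=> u; rewrite !inE => /orP[/eqP->|/eqP->]; first by rewrite mem_nbrs.
by rewrite mem_nbrs adj_sym.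
Qed.

Lemma srw_prob_deg2 x s : (forall y, y \in belast x s -> (1 < deg G y)%N) ->
  srw_prob R G x s <= 2^-1 ^+ size s.
Proof.
elim: s x => [|y s IH] x //= h; rewrite exprS.
rewrite ler_pM ?srw_prob_ge0 ?srw_step_ge0 //; last first.
  by apply: IH => z zs; apply: h; rewrite inE zs orbT.
rewrite /srw_step; case: ifP => _; last by rewrite invr_ge0.
have dx := h x (mem_head _ _); rewrite lef_pV2 ?posrE ?ltr0n ?ler_nat //.
exact: ltnW.
Qed.

Section Trial.
Variables (alpha beta : R) (K : nat).
Hypotheses (alpha0 : 0 < alpha) (beta01 : 0 < beta <= 1) (Kb : 2^-1 ^+ K <= beta).
Variables (v : V) (c : ocycle G) (s : seq V).
Hypotheses (pc : alpha <= p c) (sc : represents s c).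
Hypothesis vs : beta < srw_prob R G v (close_seq s).

(** Vertices of a cycle have degree at least 2, so a turn of length k has probability at most 2^-k;
    it is also at least beta, whence k is at most K. The word makes two turns and a last step.
    Entering the cycle and turning once has probability above beta, and so has the second turn. By
    reversibility a turn is as likely in the opposite direction, which treats the reversed word. *)
Lemma double_loop_word : exists w, [/\ (0 < size w)%N, (size w <= K.*2.+1)%N,
  beta ^+ 2 <= srw_prob R G v w, beta ^+ 2 <= srw_prob R G v (rev w) &
  alive_sup w <= 1 - alpha].
Proof.
have cs := represents_cycle sc; have /and3P[s3 us _] := cs.
case: s s3 us sc vs cs => // h s0 s3 us hsc; rewrite /close_seq => hv cs.
have b0 : 0 < beta by case/andP: beta01.
set l := srw_prob R G h (rcons s0 h).
have sl : srw_prob R G v (rcons (h :: s0) h) = srw_step R G v h * l by [].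
have bl : beta <= l.
  by rewrite (le_trans (ltW hv)) // sl ler_piMl ?srw_prob_ge0 ?srw_step_le1.
have e1 : (h :: s0) ++ (h :: s0) ++ [:: h] = (h :: rcons s0 h) ++ rcons s0 h.
  by rewrite /= cat_rcons cats1.
have lr : srw_prob R G h (rcons (rev s0) h) = l.
  have := srw_prob_rev h (rcons s0 h).
  rewrite last_rcons belast_rcons rev_cons => /mulfI; rewrite -/l => -> //.
  by rewrite pnatr_eq0 -lt0n ltnW // (cycle_deg cs) // mem_head.
have e2 : rev ((h :: s0) ++ (h :: s0) ++ [:: h]) =
    (h :: rcons (rev s0) h) ++ rcons (rev s0) h.
  by rewrite !rev_cat !rev_cons.
exists ((h :: s0) ++ (h :: s0) ++ [:: h]); split => //.
- have sK : (size (h :: s0) <= K)%N.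
    rewrite leqNgt; apply/negP => Ks; suff : l < beta by rewrite ltNge bl.
    apply: (@le_lt_trans _ _ (2^-1 ^+ size (h :: s0))).
      have -> : size (h :: s0) = size (rcons s0 h) by rewrite size_rcons.
      by apply: srw_prob_deg2 => y; rewrite belast_rcons; exact: cycle_deg.
    by apply: lt_le_trans Kb; rewrite ltr_iXn2l //; lra.
  by rewrite !size_cat addn1 addnS ltnS -addnn leq_add.
- rewrite e1 srw_prob_cat /= last_rcons expr2.
  by rewrite ler_pM // ?ltW // -sl.
- rewrite e2 srw_prob_cat /= last_rcons expr2 lr.
  by rewrite ler_pM // ?ltW // -sl.
rewrite (le_trans (alive_double_loop _)) // lerD2l lerN2.
by rewrite (loop_weight_represents hsc).
Qed.

End Trial.
End Alive.
(** * Toppling *)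

Section Pointers.
Variable V : choiceType.
Implicit Types (f g : V -> option V) (x y z u v w : V) (s c P : seq V).

Definition points f : rel V := fun x y => f x == Some y.
Definition ends f x s := path (points f) x s /\ f (last x s) = None.
(** With finitely many arrows, this says that the branch of x runs into a loop, necessarily a kept
    one. Later topplings cannot change such a branch. *)
Definition final f x := ~ exists s, ends f x s.
Definition descends f x y := exists2 s, path (points f) x s & last x s = y.
Definition leads f x u := exists2 s, ends f x s & last x s = u.

(* Empty when the path from x never ends. *)
Definition pth f x : seq V :=
  if pselect (exists s, ends f x s) is left H then x :: projT1 (cid H) else [::].

Definition upd f u v : V -> option V := fun x => if x == u then Some v else f x.
Definition clear f c : V -> option V := fun x => if x \in c then None else f x.

(** A vertex has at most one arrow, so of two paths from x one extends the other. *)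
Lemma points_prefix f x s s' : path (points f) x s -> path (points f) x s' ->
  (size s <= size s')%N -> exists s'', s' = s ++ s''.
Proof.
elim: s x s' => [|y s IH] x s' /=; first by exists s'.
case: s' => //= y' s' /andP[/eqP xy ps] /andP[/eqP]; rewrite xy => -[<-] ps'.
by move=> /(IH _ _ ps ps')[s'' ->]; exists s''.
Qed.

Lemma ends_path_size f x s s' : ends f x s -> path (points f) x s' ->
  (size s' <= size s)%N.
Proof.
move=> [ps fN] ps'; rewrite leqNgt; apply/negP => lt.
have [[|y s''] e] := points_prefix ps ps' (ltnW lt).
  by move: lt; rewrite e cats0 ltnn.
by move: ps'; rewrite e cat_path /= /points fN andbF.
Qed.

Lemma ends_unique f x s s' : ends f x s -> ends f x s' -> s = s'.
Proof.
move=> es es'; have h := ends_path_size es es'.1.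
have [s'' e] := points_prefix es'.1 es.1 h.
have := ends_path_size es' es.1; rewrite e size_cat -[leqRHS]addn0 leq_add2l leqn0.
by rewrite size_eq0 => /eqP->; rewrite cats0.
Qed.

Lemma pthE f x s : ends f x s -> pth f x = x :: s.
Proof.
move=> es; rewrite /pth; case: pselect => [H|[]]; last by exists s.
by case: cid => s' /= es'; rewrite (ends_unique es' es).
Qed.

Lemma ends_cat f x s s' : path (points f) x s -> ends f (last x s) s' ->
  ends f x (s ++ s').
Proof. by move=> ps [ps' fN]; split; rewrite ?cat_path ?last_cat ?ps. Qed.

Lemma ends_suffix f x s1 s2 : ends f x (s1 ++ s2) -> ends f (last x s1) s2.
Proof. by rewrite /ends cat_path last_cat => -[/andP[_ ?] ?]. Qed.

Lemma mem_split_last x s y : y \in x :: s -> exists s1 s2, s = s1 ++ s2 /\ last x s1 = y.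
Proof. by move=> /splitPl[s1 s2 e]; exists s1, s2. Qed.

Lemma ends_mem f x s y : ends f x s -> y \in x :: s ->
  exists2 s', ends f y s' & last y s' = last x s.
Proof.
move=> es /mem_split_last[s1 [s2 [e <-]]]; subst s.
by exists s2; [exact: ends_suffix es|rewrite last_cat].
Qed.

(** A repeated vertex would have two terminating paths of different lengths. *)
Lemma ends_uniq f x s : ends f x s -> uniq (x :: s).
Proof.
elim: s x => //= y s IH x es.
have ey : ends f y s by exact: (@ends_suffix f x [:: y] s).
rewrite (IH _ ey) andbT; apply/negP => /mem_split_last[s1 [s2 [e l]]].
have e2 := ends_suffix (eq_ind _ (ends f y) ey _ e); rewrite l in e2.
have := congr1 size (ends_unique es e2); rewrite /= e size_cat => /eqP.
by rewrite eqn_leq ltnNge leq_addl.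
Qed.

Lemma last_of_None f x s y : path (points f) x s -> y \in x :: s -> f y = None ->
  y = last x s.
Proof.
move=> ps /mem_split_last[s1 [[|z s2] [e <-]]]; subst s; first by rewrite cats0.
by move: ps; rewrite cat_path /= /points => /and3P[_ /eqP-> _].
Qed.

Lemma leads_disjoint f x s x' s' y : ends f x s -> ends f x' s' ->
  last x s <> last x' s' -> y \in x :: s -> y \notin x' :: s'.
Proof.
move=> es es' ne ys; apply/negP => ys'; apply: ne.
have [s1 e1 <-] := ends_mem es ys; have [s2 e2 <-] := ends_mem es' ys'.
by rewrite (ends_unique e1 e2).
Qed.

Lemma leads_inj f x u w : leads f x u -> leads f x w -> u = w.
Proof. by move=> [s es <-] [s' es' <-]; rewrite (ends_unique es es'). Qed.

Lemma leads_pth f x u : leads f x u ->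
  exists s, [/\ ends f x s, last x s = u & pth f x = x :: s].
Proof. by move=> [s es <-]; exists s; rewrite (pthE es). Qed.

Lemma eq_path_points f g x s : (forall y, y \in belast x s -> f y = g y) ->
  path (points f) x s -> path (points g) x s.
Proof.
elim: s x => //= y s IH x h /andP[xy ps]; apply/andP; split.
  by rewrite /points -h ?mem_head.
by apply: IH => // z zs; apply: h; rewrite inE zs orbT.
Qed.

Lemma eq_ends f g x s : (forall y, y \in x :: s -> f y = g y) ->
  ends f x s -> ends g x s.
Proof.
move=> h [ps fN]; split; last by rewrite -h // mem_last.
by apply: eq_path_points ps => y /mem_belast; exact: h.
Qed.

Lemma descends_refl f x : descends f x x. Proof. by exists [::]. Qed.

Lemma descends_trans f y x z : descends f x y -> descends f y z -> descends f x z.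
Proof.
move=> [s ps e] [s' ps' <-]; exists (s ++ s').
  by rewrite cat_path ps e.
by rewrite last_cat e.
Qed.

Lemma descends_points f x y : f x = Some y -> descends f x y.
Proof. by move=> e; exists [:: y] => //=; rewrite /points e eqxx. Qed.

Lemma descends_mem f x s y : path (points f) x s -> y \in x :: s -> descends f x y.
Proof.
move=> ps /mem_split_last[s1 [s2 [e l]]]; exists s1 => //.
by move: ps; rewrite e cat_path => /andP[].
Qed.

Lemma final_descends f x y : final f x -> descends f x y -> final f y.
Proof.
by move=> fx [s ps <-] [s' es']; apply: fx; exists (s ++ s'); exact: ends_cat.
Qed.

Lemma descends_final f x y : descends f x y -> final f y -> final f x.
Proof.
move=> [s ps <-] fy [s' es']; apply: fy.
have [s'' e] := points_prefix ps es'.1 (ends_path_size es' ps).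
by exists s''; apply: ends_suffix; rewrite -e.
Qed.

Lemma final_Some f x : final f x -> f x <> None.
Proof. by move=> fx fN; apply: fx; exists [::]. Qed.

Lemma final_cycle f x s : path (points f) x s -> s != [::] -> last x s = x -> final f x.
Proof.
move=> ps s0 l [s' es'].
have ps2 : path (points f) x (s ++ s') by rewrite cat_path ps l es'.1.
have := ends_path_size es' ps2; rewrite size_cat -[leqRHS]add0n leq_add2r leqn0.
by rewrite size_eq0 (negbTE s0).
Qed.

Lemma transfer_path f g x s : (forall y, descends f x y -> f y = g y) ->
  path (points g) x s -> path (points f) x s.
Proof.
elim: s x => //= y s IH x h /andP[xy ps].
have xy' : f x = Some y by rewrite h; [exact/eqP|exact: descends_refl].
rewrite {1}/points xy' eqxx /=; apply: IH => // z yz; apply: h.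
exact: descends_trans (descends_points xy') yz.
Qed.

Lemma transfer_descends f g x z : (forall y, descends f x y -> f y = g y) ->
  descends g x z <-> descends f x z.
Proof.
move=> h; split=> -[s ps l]; exists s => //; first exact: transfer_path ps.
by apply: eq_path_points (ps) => y /mem_belast ys; apply: h; exact: descends_mem ps ys.
Qed.

Lemma transfer_final f g x : (forall y, descends f x y -> f y = g y) ->
  final f x -> final g x.
Proof.
move=> h fx [s [ps gN]]; apply: fx; exists s.
have pf := transfer_path h ps; split=> //; rewrite h //; by exists s.
Qed.

Lemma upd_neq f u v x : x != u -> upd f u v x = f x.
Proof. by rewrite /upd => /negbTE->. Qed.

Lemma upd_eq f u v : upd f u v u = Some v. Proof. by rewrite /upd eqxx. Qed.

Lemma clear_notin f c x : x \notin c -> clear f c x = f x.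
Proof. by rewrite /clear => /negbTE->. Qed.

Lemma clear_None f c x : f x = None -> clear f c x = None.
Proof. by rewrite /clear => ->; case: ifP. Qed.

Lemma final_upd f u v x : f u = None -> final f x ->
  final (upd f u v) x /\ forall z, descends (upd f u v) x z <-> descends f x z.
Proof.
move=> fu fx.
have h y : descends f x y -> f y = upd f u v y.
  move=> xy; rewrite upd_neq //; apply/eqP => e; subst y.
  exact: final_Some (final_descends fx xy) fu.
by split; [exact: transfer_final fx|move=> z; exact: transfer_descends].
Qed.

(** Erased vertices have terminating branches, so a final branch meets none of them. *)
Lemma final_clear f v u x : leads f v u -> final f x ->
  final (clear f (pth f v)) x /\
  forall z, descends (clear f (pth f v)) x z <-> descends f x z.
Proof.
move=> /leads_pth[s [es _ ->]] fx.
have h y : descends f x y -> f y = clear f (v :: s) y.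
  move=> xy; rewrite clear_notin //; apply/negP => /(ends_mem es)[s' es' _].
  by apply: (final_descends fx xy); exists s'.
by split; [exact: transfer_final fx|move=> z; exact: transfer_descends].
Qed.

Lemma ends_upd f u v x s : u \notin x :: s -> ends f x s -> ends (upd f u v) x s.
Proof.
move=> us; apply: eq_ends => y ys; rewrite upd_neq //.
by apply: contraNneq us => <-.
Qed.

Lemma ends_upd_other f u v x s : f u = None -> u <> last x s -> ends f x s ->
  ends (upd f u v) x s.
Proof.
move=> fu ul es; apply: ends_upd (es); apply/negP => us; apply: ul.
exact: last_of_None es.1 us fu.
Qed.

Lemma ends_clear_other f x s v u : leads f v u -> u <> last x s -> ends f x s ->
  ends (clear f (pth f v)) x s.
Proof.
move=> /leads_pth[s' [es' l ->]] ul es; apply: eq_ends (es) => y ys.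
by rewrite clear_notin // (leads_disjoint es es') // l => /esym.
Qed.

Lemma path_upd_last f u v x s : f u = None -> ends f x s -> last x s = u ->
  path (points (upd f u v)) x s.
Proof.
move=> fu es l; apply: eq_path_points es.1 => y ys; rewrite upd_neq //.
have := ends_uniq es; rewrite lastI rcons_uniq l => /andP[+ _].
by apply: contraNneq => <-.
Qed.

(** A terminating path of the new map either avoids u, or reaches u and goes on from v; having no
    repeated vertex, it passes u only once. *)
Lemma leads_upd f u v x w : f u = None -> u != w ->
  leads (upd f u v) x w <-> leads f x w \/ (leads f x u /\ leads f v w).
Proof.
move=> fu uw; split; last first.
  case=> [[s es l]|[[s es l] [s' es' l']]].
    by exists s => //; apply: ends_upd_other => //; rewrite l; exact/eqP.
  exists (s ++ v :: s'); last by rewrite last_cat.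
  apply: ends_cat; first exact: path_upd_last.
  have e2 : ends (upd f u v) v s'.
    by apply: ends_upd_other => //; rewrite l'; exact/eqP.
  by rewrite l; apply: (@ends_cat _ u [:: v] s') => //=; rewrite /points upd_eq eqxx.
case=> s es l; have [us|us] := boolP (u \in x :: s); last first.
  left; exists s => //; apply: eq_ends es => y ys; rewrite upd_neq //.
  by apply: contraNneq us => <-.
right; have := ends_uniq es; move: us es l => /splitPl[s1 s2 l1] es l un.
have es2 := ends_suffix es; rewrite l1 in es2.
move: es l un es2; case: s2 => [|v' s2] es l un es2.
  by move: l; rewrite cats0 l1 => e; rewrite e eqxx in uw.
have v'v : v' = v by case: es2 => /= /andP[]; rewrite /points upd_eq => /eqP[].
subst v'; have es3 : ends (upd f u v) v s2 by exact: (@ends_suffix _ u [:: v]).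
move: un; rewrite -cat_cons cat_uniq => /and3P[un1 dis un2]; split.
  exists s1 => //; split; last by rewrite l1.
  have : path (points (upd f u v)) x s1 by case: es; rewrite cat_path => /andP[].
  apply: eq_path_points => y ys; rewrite upd_neq //.
  move: un1; rewrite lastI rcons_uniq l1 => /andP[+ _].
  by apply: contraNneq => <-.
exists s2; last by rewrite -l last_cat.
apply: eq_ends es3 => y ys; rewrite upd_neq //.
apply: contraNneq dis => e; apply/hasP; exists y => //=.
by rewrite e -l1 mem_last.
Qed.

Lemma leads_clear f u v x w : leads f v u -> f w = None -> u != w ->
  leads (clear f (pth f v)) x w <-> leads f x w.
Proof.
move=> vu fw uw; split=> [[s es l]|[s es l]]; last first.
  by exists s => //; apply: ends_clear_other vu _ es; rewrite l; exact/eqP.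
exists s => //; apply: eq_ends (es) => y ys.
have [s' [es' l' e]] := leads_pth vu; rewrite e in es *.
apply: clear_notin; apply/negP => yc.
have cy : clear f (v :: s') y = None by rewrite /clear yc.
have yw := last_of_None es.1 ys cy; rewrite l in yw; subst y.
have := last_of_None es'.1 yc fw; rewrite l' => e2.
by rewrite e2 eqxx in uw.
Qed.

End Pointers.

(** * Topplings as conditional expectations, and their commutation *)

Section Topple.
Variables (R : realType) (V : choiceType) (G : lfgraph V) (p : ocycle G -> R).
Hypothesis p01 : forall c, 0 <= p c <= 1.
Implicit Types (f : V -> option V) (x y z u v w : V) (h : (V -> option V) -> R).

(* Conditional expectation of h once u is made to point to v: the loop closed
   by this arrow, if any, is kept with probability its weight. *)
Definition topple_to u v h f : R :=
  if `[< leads f v u >] then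
    let q := loop_weight p (pth f v) in
    q * h (upd f u v) + (1 - q) * h (clear f (pth f v))
  else h (upd f u v).

Definition topple u h f : R := avg G u (fun v => topple_to u v h f).

Lemma topple_to_leads u v h f : leads f v u -> topple_to u v h f =
  loop_weight p (pth f v) * h (upd f u v) +
  (1 - loop_weight p (pth f v)) * h (clear f (pth f v)).
Proof. by move=> vu; rewrite /topple_to asboolT. Qed.

Lemma topple_to_fresh u v h f : ~ leads f v u -> topple_to u v h f = h (upd f u v).
Proof. by move=> vu; rewrite /topple_to asboolF. Qed.

Lemma upd_comm f u v w v' : u != w -> upd (upd f u v) w v' = upd (upd f w v') u v.
Proof.
move=> uw; apply/funext => x; rewrite /upd; case: eqP => [->|//].
by rewrite eq_sym (negbTE uw).
Qed.

Lemma clear_upd f u v c : u \notin c -> clear (upd f u v) c = upd (clear f c) u v.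
Proof.
move=> uc; apply/funext => x; rewrite /clear /upd; case: (x =P u) => [->|//].
by rewrite (negbTE uc).
Qed.

Lemma clear_comm f c c' : clear (clear f c) c' = clear (clear f c') c.
Proof. by apply/funext => x; rewrite /clear; do 2 case: ifP. Qed.

(* Two arrows close either disjoint loops, or a common loop which is closed by
   the last of them in both orders. *)
Lemma topple_to_comm f u v w v' h : u != w -> f u = None -> f w = None ->
  topple_to u v (topple_to w v' h) f = topple_to w v' (topple_to u v h) f.
Proof.
move=> uw fu fw; have wu : w != u by rewrite eq_sym.
have notin x y t : leads f x y -> f t = None -> y != t -> t \notin pth f x.
  move=> /leads_pth[s [es l ->]] ft yt; apply/negP => ts.
  by move: yt; rewrite -l -(last_of_None es.1 ts ft) eqxx.
have pu x a b : leads f x a -> f b = None -> b != a -> forall y,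
    pth (upd f b y) x = pth f x.
  move=> /leads_pth[s [es l ->]] fb ba y; apply: pthE.
  by apply: ends_upd_other => //; rewrite l; exact/eqP.
have pc x a y b : leads f x a -> leads f y b -> b != a ->
    pth (clear f (pth f y)) x = pth f x.
  move=> /leads_pth[s [es l ->]] yb ba; apply: pthE.
  by apply: ends_clear_other yb _ es; rewrite l; exact/eqP.
have half a x b y : a != b -> f a = None -> f b = None ->
    leads f x a -> ~ leads f y b ->
    topple_to a x (topple_to b y h) f = topple_to b y (topple_to a x h) f.
  move=> ab fa fb xa yb; have ba : b != a by rewrite eq_sym.
  rewrite (topple_to_leads _ xa) (topple_to_fresh _ yb).
  rewrite (@topple_to_fresh b y _ (upd f a x)); last first.
    case/(leads_upd _ _ fa ab) => // -[_ /(leads_inj xa)/eqP].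
    by rewrite (negbTE ab).
  rewrite (@topple_to_fresh b y _ (clear _ _)); last first.
    by move/(leads_clear _ xa fb ab).
  rewrite (@topple_to_leads a x _ (upd f b y)); last first.
    by apply/(leads_upd _ _ fb ba); left.
  by rewrite (pu _ _ _ xa) // clear_upd ?(notin _ _ _ xa) // (@upd_comm f a x).
have [vu|vu] := pselect (leads f v u); have [v'w|v'w] := pselect (leads f v' w).
- rewrite !(topple_to_leads _ vu) !(topple_to_leads _ v'w).
  rewrite (@topple_to_leads w v' _ (upd f u v)); last first.
    by apply/(leads_upd _ _ fu uw); left.
  rewrite (@topple_to_leads w v' _ (clear _ _)); last first.
    exact/(leads_clear _ vu fw uw).
  rewrite (@topple_to_leads u v _ (upd f w v')); last first.
    by apply/(leads_upd _ _ fw wu); left.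
  rewrite (@topple_to_leads u v _ (clear _ _)); last first.
    exact/(leads_clear _ v'w fu wu).
  rewrite (pu _ _ _ vu) // (pu _ _ _ v'w) // (pc _ _ _ _ vu v'w) // (pc _ _ _ _ v'w vu) //.
  rewrite !clear_upd ?(notin _ _ _ vu) ?(notin _ _ _ v'w) // (@upd_comm f u v) //.
  by rewrite (@clear_comm f (pth f v)); ring.
- exact: half.
- by rewrite -half.
rewrite (topple_to_fresh _ vu) (topple_to_fresh _ v'w).
(* Neither arrow closes a loop alone; both together do exactly when v leads to w and v' leads to u.
   The loop is then read from v' in one order and from v in the other, which are rotations of each
   other and have the same weight. *)
have [[v'u vw]|n] := pselect (leads f v' u /\ leads f v w).
  rewrite (@topple_to_leads w v'); last by apply/(leads_upd _ _ fu uw); right.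
  rewrite (@topple_to_leads u v); last by apply/(leads_upd _ _ fw wu); right.
  have [s [es l _]] := leads_pth vw; have [s' [es' l' _]] := leads_pth v'u.
  have join a b x t y t' : a <> b -> f a = None -> ends f x t -> last x t = a ->
      ends f y t' -> last y t' = b -> pth (upd f a y) x = x :: t ++ y :: t'.
    move=> ab fa et lt et' lt'; apply: pthE; apply: ends_cat.
      exact: path_upd_last.
    rewrite lt; apply: (@ends_cat _ _ a [:: y] t') => /=.
      by rewrite /points upd_eq eqxx.
    by apply: ends_upd_other => //; rewrite lt'.
  have nuw : u <> w by exact/eqP.
  rewrite (join u w v' s' v s) // (join w u v s v' s') //; last exact/nesym.
  have -> : v :: s ++ v' :: s' = rot (size (v' :: s')) (v' :: s' ++ v :: s).
    by rewrite -cat_cons rot_size_cat.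
  rewrite loop_weight_rot (@upd_comm f u v) //; congr (_ + _ * h _).
  apply/funext => x; rewrite /clear mem_rot; case: ifPn => // xc.
  have xu : x != u.
    by apply: contraNneq xc => ->; rewrite -cat_cons mem_cat -l' mem_last.
  have xw : x != w.
    by apply: contraNneq xc => ->; rewrite -cat_cons mem_cat -l mem_last orbT.
  by rewrite !upd_neq.
rewrite topple_to_fresh; last by case/(leads_upd _ _ fu uw).
rewrite topple_to_fresh; last by case/(leads_upd _ _ fw wu) => // -[? ?]; apply: n.
by rewrite upd_comm.
Qed.

Lemma ler_topple_to u v h h' f : h (upd f u v) <= h' (upd f u v) ->
  (leads f v u -> h (clear f (pth f v)) <= h' (clear f (pth f v))) ->
  topple_to u v h f <= topple_to u v h' f.
Proof.
move=> h1 h2; rewrite /topple_to; case: asboolP => // vu.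
by rewrite lerD // ler_wpM2l ?loop_weight_ge0 ?loop_weight_le1 // h2.
Qed.

Lemma eq_topple_to u v h h' f : h (upd f u v) = h' (upd f u v) ->
  (leads f v u -> h (clear f (pth f v)) = h' (clear f (pth f v))) ->
  topple_to u v h f = topple_to u v h' f.
Proof.
by move=> h1 h2; apply/eqP; rewrite eq_le !ler_topple_to ?h1 // => vu; rewrite h2.
Qed.

Lemma topple_to_le u v h f c : h (upd f u v) <= c ->
  (leads f v u -> h (clear f (pth f v)) <= c) -> topple_to u v h f <= c.
Proof.
move=> h1 h2; rewrite /topple_to; case: asboolP => // vu.
rewrite (_ : c = loop_weight p (pth f v) * c + (1 - loop_weight p (pth f v)) * c); last by ring.
by rewrite lerD // ler_wpM2l ?loop_weight_ge0 ?loop_weight_le1 // h2.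
Qed.

Lemma topple_to_ge0 u v h f : (forall f', 0 <= h f') -> 0 <= topple_to u v h f.
Proof.
move=> h0; rewrite /topple_to; case: asboolP => // vu.
by rewrite addr_ge0 // mulr_ge0 ?loop_weight_ge0 ?loop_weight_le1.
Qed.

Lemma topple_to_avg u v w (k : V -> (V -> option V) -> R) f :
  topple_to u v (fun f' => avg G w (k ^~ f')) f = avg G w (fun v' => topple_to u v (k v') f).
Proof.
rewrite /topple_to; case: asboolP => // vu.
by rewrite -!avgZ -avgD.
Qed.

Lemma topple_comm u w h f : u != w -> f u = None -> f w = None ->
  topple u (topple w h) f = topple w (topple u h) f.
Proof.
move=> uw fu fw; rewrite /topple.
under eq_avg do rewrite topple_to_avg; under [RHS]eq_avg do rewrite topple_to_avg.
rewrite /avg; under eq_bigr do rewrite mulr_sumr; rewrite exchange_big /=.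
apply: eq_bigr => v' _; rewrite mulr_sumr; apply: eq_bigr => v _.
by rewrite topple_to_comm // mulrCA.
Qed.

End Topple.

(** * Building one branch by successive topplings *)

Section Run.
Variables (R : realType) (V : choiceType) (G : lfgraph V) (p : ocycle G -> R).
Hypothesis p01 : forall c, 0 <= p c <= 1.
Implicit Types (f : V -> option V) (x y z u v w : V) (P : seq V).
Implicit Types (h phi : (V -> option V) -> R).

(** The next vertex to topple on the branch of y. The value is y when the branch never ends, a case
    in which [run] does not consult it. *)
Definition tip f y := last y (pth f y).

Lemma tip_leads f y s : ends f y s -> tip f y = last y s.
Proof. by move=> es; rewrite /tip (pthE es). Qed.

Lemma not_final_ends f y : ~ final f y -> exists s, ends f y s.
Proof. by move=> h; apply: contrapT. Qed.

(* The branch from y is built first; d is the value of a branch still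
   unfinished after n topplings. *)
Fixpoint run d phi y n f : R :=
  if `[< final f y >] then phi f
  else if n is n'.+1 then topple p (tip f y) (run d phi y n') f else d.

Lemma run_final d phi y n f : final f y -> run d phi y n f = phi f.
Proof. by case: n => [|n] fy /=; rewrite asboolT. Qed.

Lemma run0 d phi y f : ~ final f y -> run d phi y 0 f = d.
Proof. by move=> fy /=; rewrite asboolF. Qed.

Lemma runS d phi y n f : ~ final f y ->
  run d phi y n.+1 f = topple p (tip f y) (run d phi y n) f.
Proof. by move=> fy /=; rewrite asboolF. Qed.

Lemma run_ge0 d phi y n f : 0 <= d -> (forall f', 0 <= phi f') -> 0 <= run d phi y n f.
Proof.
move=> d0 phi0; elim: n f => [|n IH] f /=; case: ifP => // _.
by apply: avg_ge0 => v _; exact: topple_to_ge0.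
Qed.

Lemma run_le1 d phi y n f : d <= 1 -> (forall f', phi f' <= 1) -> run d phi y n f <= 1.
Proof.
move=> d1 phi1; elim: n f => [|n IH] f /=; case: ifP => // _.
by apply: avg_le => // v _; exact: topple_to_le.
Qed.

Section Payoff.
Variables y z : V.

Definition hits f : R := (`[< descends f y z >])%:R.

Lemma hits_upd f w v : final f y -> f w = None -> hits (upd f w v) = hits f.
Proof. by move=> fy fw; rewrite /hits (propext ((final_upd v fw fy).2 z)). Qed.

Lemma hits_clear f w v : final f y -> leads f v w -> hits (clear f (pth f v)) = hits f.
Proof. by move=> fy vw; rewrite /hits (propext ((final_clear vw fy).2 z)). Qed.

Notation reach := (run 0 hits y).

(** An unfinished branch counts as 0, so granting one more toppling can only increase the value. *)
Lemma reach_nondecreasing n f : reach n f <= reach n.+1 f.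
Proof.
elim: n f => [|n IH] f.
  have [fy|fy] := pselect (final f y); first by rewrite !run_final.
  by rewrite run0 // run_ge0.
have [fy|fy] := pselect (final f y); first by rewrite !run_final.
rewrite runS // [leRHS]runS //; apply: ler_avg => v _; exact: ler_topple_to.
Qed.

(* Toppling elsewhere first does not help: topplings at distinct vertices
   commute, and the one at w does not move the end of the path from y. *)
Lemma reach_topple n f w : f w = None -> topple p w (reach n) f <= reach n.+1 f.
Proof.
elim: n f w => [|n IH] f w fw.
  have [fy|/[dup] fy /not_final_ends[s es]] := pselect (final f y).
    rewrite run_final //; apply: avg_le => [|v _]; first by rewrite ler0n.
    apply: topple_to_le => // [|vw].
      by rewrite run_final ?hits_upd //; exact: (final_upd v fw fy).1.
    by rewrite run_final ?(hits_clear fy vw) //; exact: (final_clear vw fy).1.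
  rewrite runS // (tip_leads es); have [->//|wu] := eqVneq w (last y s).
  (* With no toppling left, an arrow out of another vertex than the tip cannot complete the branch
     of y: the left side is 0. *)
  apply: (@le_trans _ _ 0); last first.
    by apply: avg_ge0 => v _; apply: topple_to_ge0 => // f'; exact: run_ge0.
  apply: avg_le => // v _; apply: topple_to_le => // [|vw]; rewrite run0 //.
    by apply; exists s; apply: ends_upd_other => //; exact/eqP.
  by apply; exists s; apply: ends_clear_other vw _ es; exact/eqP.
have [fy|/[dup] fy /not_final_ends[s es]] := pselect (final f y).
  rewrite run_final //; apply: avg_le => [|v _]; first by rewrite ler0n.
  apply: topple_to_le => // [|vw].
    by rewrite run_final ?hits_upd //; exact: (final_upd v fw fy).1.
  by rewrite run_final ?(hits_clear fy vw) //; exact: (final_clear vw fy).1.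
rewrite [leRHS]runS // (tip_leads es); set u := last y s.
have [->//|wu] := eqVneq w u.
have fu : f u = None by case: es.
have wu' : w <> u by exact/eqP.
(* The toppling of w does not move the end u of the branch, so u is toppled next in every
   outcome. *)
have -> : topple p w (reach n.+1) f = topple p w (topple p u (reach n)) f.
  apply: eq_avg => v _; apply: (eq_topple_to p01) => [|vw].
    have es' : ends (upd f w v) y s by exact: ends_upd_other.
    by rewrite runS ?(tip_leads es') //; apply; exists s.
  have es' := ends_clear_other vw wu' es.
  by rewrite runS ?(tip_leads es') //; apply; exists s.
rewrite topple_comm //; apply: ler_avg => v _; apply: ler_topple_to => // [|_].
  by apply: IH; rewrite upd_neq.
by apply: IH; rewrite clear_None.
Qed.

(** The probability that the branch of y, built at once from f, is completed and passes through
    z. *)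
Definition reach_lim f : R := limn (reach ^~ f).

Lemma reach_cvg f : reach ^~ f @ \oo --> reach_lim f.
Proof.
apply: nondecreasing_is_cvgn; first by apply/nondecreasing_seqP => n; exact: reach_nondecreasing.
exists 1 => _ [n _ <-]; apply: run_le1 => // f'.
by rewrite /hits lern1 leq_b1.
Qed.

Lemma reach_lim_ge0 f : 0 <= reach_lim f.
Proof.
apply: limr_ge; first by apply/cvg_ex; exists (reach_lim f); exact: reach_cvg.
by near=> t; exact: run_ge0.
Unshelve. all: by end_near.
Qed.

Lemma reach_lim_final f : final f y -> reach_lim f = hits f.
Proof.
move=> fy; apply/cvg_lim => //.
under eq_fun do rewrite run_final //; exact: cvg_cst.
Qed.

(** The supermartingale property: the extra toppling granted in [reach_topple] disappears in the
    limit. *)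
Lemma reach_lim_topple f w : f w = None -> topple p w reach_lim f <= reach_lim f.
Proof.
move=> fw.
have h1 : topple p w (reach n) f @[n --> \oo] --> topple p w reach_lim f.
  apply: cvg_avg => v; rewrite /topple_to; case: ifP => _; last exact: reach_cvg.
  by apply: cvgD; apply: cvgM; (exact: cvg_cst || exact: reach_cvg).
have h2 : reach n.+1 f @[n --> \oo] --> reach_lim f.
  by rewrite (cvg_shiftS (reach ^~ f)); exact: reach_cvg.
apply: ler_cvg_to h1 h2 _; near=> n; exact: reach_topple.
Unshelve. all: by end_near.
Qed.

End Payoff.

(** The invariant between two phases: no branch is left under construction. *)
Definition good f := forall x, f x <> None -> final f x.

Lemma good_empty : good (fun=> None). Proof. by []. Qed.

(* State while building the branch P from a, starting from the good state f0. *)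
Record branch f0 a P f := Branch {
  branch_ends : exists2 s, P = a :: s & ends f a s;
  branch_dom : forall x, f x <> None -> f0 x <> None \/ x \in P;
  branch_ext : forall x, f0 x <> None -> f x = f0 x }.

(* State once this branch is completed. *)
Record completed f0 P f := Completed {
  completed_good : good f;
  completed_ext : forall x, f0 x <> None -> f x = f0 x;
  completed_dom : forall x, f x <> None <-> f0 x <> None \/ x \in P }.

Lemma ext_final f0 f x : good f0 -> (forall x, f0 x <> None -> f x = f0 x) ->
  f0 x <> None -> final f x.
Proof.
move=> g0 h fx; apply: transfer_final (g0 _ fx) => y xy.
rewrite h //; apply: final_Some; exact: final_descends (g0 _ fx) xy.
Qed.

Lemma branch0 f0 a : f0 a = None -> branch f0 a [:: a] f0.
Proof. by move=> fa; split; [exists [::]|left|]. Qed.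

Section BranchFacts.
Variables (f0 : V -> option V) (a : V) (P : seq V) (f : V -> option V).
Hypotheses (g0 : good f0) (bf : branch f0 a P f).
Let u := last a P.

Lemma branch_final x : f0 x <> None -> final f x.
Proof. exact: ext_final g0 (branch_ext bf). Qed.

Lemma branch_pth : pth f a = P.
Proof. by case: (branch_ends bf) => s -> es; exact: pthE. Qed.

Lemma branch_tip : tip f a = u.
Proof. by rewrite /tip branch_pth. Qed.

Lemma branch_tip_None : f u = None.
Proof. by rewrite /u; case: (branch_ends bf) => s -> []. Qed.

Lemma branch_not_final : ~ final f a.
Proof. by case: (branch_ends bf) => s _ es; apply; exists s. Qed.

Lemma branch_uniq : uniq P.
Proof. by case: (branch_ends bf) => s -> /ends_uniq. Qed.

Lemma branch_mem_None x : x \in P -> f0 x = None.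
Proof.
case: (branch_ends bf) => s -> es /(ends_mem es)[s' es' _]; apply: contrapT.
by move=> /branch_final; apply; exists s'.
Qed.

Lemma branch_tip_mem : u \in P.
Proof. by rewrite /u; case: (branch_ends bf) => s -> _; rewrite [last _ _]/= mem_last. Qed.

Lemma branch_a_mem : a \in P.
Proof. by case: (branch_ends bf) => s -> _; exact: mem_head. Qed.

Lemma branch_split v : v \in P -> exists s1 s2, [/\ P = belast a s1 ++ v :: s2,
  ends f a (s1 ++ s2), last a s1 = v, take (index v P).+1 P = a :: s1 &
  drop (index v P) P = v :: s2].
Proof.
have := branch_uniq; have := branch_ends bf => -[s -> es] us vs.
move: (vs) => /mem_split_last[s1 [s2 [e l]]]; exists s1, s2.
have eP : a :: s = belast a s1 ++ v :: s2.
  by rewrite e -cat_cons lastI l cat_rcons.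
have vb : v \notin belast a s1.
  move: us; rewrite eP cat_uniq => /and3P[_ /hasPn h _].
  by apply: h; exact: mem_head.
rewrite eP drop_index_cat // take_index_cat // -e; split => //.
by rewrite lastI l.
Qed.

Lemma branch_mem_ends v : v \in P -> exists s,
  [/\ drop (index v P) P = v :: s, ends f v s & last v s = u].
Proof.
move=> /branch_split[s1 [s2 [eP es l _ ->]]]; exists s2; split=> //.
  by rewrite -l; apply: ends_suffix.
by rewrite /u eP last_cat.
Qed.

Lemma branch_leads v : v \in P -> leads f v u /\ pth f v = drop (index v P) P.
Proof. by move=> /branch_mem_ends[s [-> es l]]; split; [exists s|exact: pthE]. Qed.

Lemma branch_not_leads v : v \notin P -> ~ leads f v u.
Proof.
move=> vP [s es l]; case: s => [|v' s] in es l *.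
  by move: vP; rewrite -[v]/(last v [::]) l branch_tip_mem.
have : f v <> None by case: es => /= /andP[/eqP->].
case/(branch_dom bf); last by apply/negP.
by move=> /branch_final; apply; exists (v' :: s).
Qed.

(** The new arrow either closes a kept loop or leads into the finished part. In both cases the tip
    becomes final, and every vertex of P descends to the tip. *)
Lemma branch_completed v : v \in P \/ f0 v <> None -> completed f0 P (upd f u v).
Proof.
move=> vP; have fu := branch_tip_None.
have ff x : f0 x <> None -> final (upd f u v) x.
  by move=> /branch_final fx; exact: (final_upd v fu fx).1.
have toU x : x \in P -> descends (upd f u v) x u.
  move=> /branch_mem_ends[s [_ es l]]; exists s => //; exact: path_upd_last.
have fU : final (upd f u v) u.
  case: vP => [vP|vf]; last first.
    by apply: descends_final (ff _ vf); apply: descends_points; rewrite upd_eq.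
  have [s ps l] := toU _ vP; apply: (@final_cycle _ _ _ (v :: s)) => //=.
  by rewrite ps /points upd_eq eqxx.
have dom x : upd f u v x <> None <-> f0 x <> None \/ x \in P.
  split.
    have [->|xu] := eqVneq x u; first by right; exact: branch_tip_mem.
    by rewrite upd_neq //; exact: (branch_dom bf).
  case=> [/ff fx|xP]; apply: final_Some => //.
  exact: descends_final (toU _ xP) fU.
split=> // [x /dom[/ff//|xP]|x fx].
  exact: descends_final (toU _ xP) fU.
rewrite upd_neq ?(branch_ext bf) //; apply/eqP => e; move: fx.
by rewrite e branch_mem_None // branch_tip_mem.
Qed.

Lemma branch_extend v : v \notin P -> f0 v = None -> branch f0 a (rcons P v) (upd f u v).
Proof.
move=> vP f0v; have fu := branch_tip_None.
have fv : f v = None by apply: contrapT => /(branch_dom bf)[//|]; exact/negP.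
have uv : v != u by apply: contraNneq vP => ->; exact: branch_tip_mem.
case: (branch_ends bf) => s eP es; split.
- exists (rcons s v); first by rewrite eP.
  split; last by rewrite last_rcons upd_neq.
  rewrite rcons_path path_upd_last //; last by rewrite /u eP.
  by rewrite /points (_ : last a s = u) ?upd_eq //= /u eP.
- move=> x; have [->|xu] := eqVneq x u.
    by move=> _; right; rewrite mem_rcons inE branch_tip_mem orbT.
  rewrite upd_neq // => /(branch_dom bf)[|xP]; first by left.
  by right; rewrite mem_rcons inE xP orbT.
- move=> x fx; rewrite upd_neq ?(branch_ext bf) //; apply/eqP => e; move: fx.
  by rewrite e branch_mem_None // branch_tip_mem.
Qed.

Lemma branch_clear v : v \in P ->
  branch f0 a (take (index v P).+1 P) (clear f (drop (index v P) P)).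
Proof.
move=> vP; have [s1 [s2 [eP es l -> ->]]] := branch_split vP.
have := branch_uniq; rewrite eP cat_uniq => /and3P[_ /hasPn dis _].
split.
- exists s1 => //; split; last by rewrite l /clear mem_head.
  have ps : path (points f) a s1 by case: es; rewrite cat_path => /andP[].
  apply: eq_path_points ps => y yb; rewrite clear_notin //.
  by apply/negP => /dis; rewrite yb.
- move=> x; rewrite /clear; case: ifPn => // xd /(branch_dom bf)[|]; first by left.
  rewrite eP mem_cat (negbTE xd) orbF => xb; right; exact: mem_belast.
- move=> x fx; rewrite clear_notin ?(branch_ext bf) //; apply/negP => xs.
  by apply: fx; apply: branch_mem_None; rewrite eP mem_cat xs orbT.
Qed.

End BranchFacts.

Lemma branch_last_take a (P : seq V) v : v \in P -> last a (take (index v P).+1 P) = v.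
Proof.
by move=> vP; rewrite (take_nth v) ?index_mem // nth_index // last_rcons.
Qed.

(** P is the current path read by [alive]. Keeping a loop or stepping on the domain of f0 completes
    the branch, where the value is 0; only the killing by kept loops is retained on the right. *)
Lemma unfinished_le_alive f0 a P f n : good f0 -> branch f0 a P f ->
  run 1 (fun=> 0) a n f <= walk_sum G n (last a P) (alive p P).
Proof.
move=> g0; elim: n P f => [|n IH] P f bf.
  by rewrite run0 //; exact: branch_not_final bf.
rewrite runS; last exact: branch_not_final bf.
rewrite (branch_tip bf); apply: ler_avg => v _.
rewrite -[leRHS]/(walk_sum G n v (fun s => alive p P (v :: s))).
have fin : v \in P \/ f0 v <> None -> run 1 (fun=> 0) a n (upd f (last a P) v) = 0.
  move=> h; rewrite run_final //; have c := branch_completed g0 bf h.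
  by apply: (completed_good c); apply/(completed_dom c); right; exact: branch_a_mem bf.
have [vP|vP] := boolP (v \in P).
  have [vu pv] := branch_leads bf vP.
  rewrite topple_to_leads // pv fin ?mulr0 ?add0r; last by left.
  under eq_walk_sum do rewrite /= vP /=.
  rewrite walk_sumZ ler_wpM2l ?loop_weight_le1 //.
  apply: (le_trans (IH _ _ (branch_clear g0 bf vP))).
  by rewrite branch_last_take.
rewrite topple_to_fresh; last exact: (branch_not_leads g0 bf vP).
have [f0v|f0v] := pselect (f0 v = None); last first.
  by rewrite fin; [apply: walk_sum_ge0 => s; exact: alive_ge0|right].
under eq_walk_sum do rewrite /= vP.
apply: (le_trans (IH _ _ (branch_extend g0 bf vP f0v))).
by rewrite last_rcons.
Qed.

(** If z ends up on the branch, then z is already on P or the walk visits z before keeping a loop.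
    The probability of such a visit is bounded by the expected number of visits. *)
Lemma reach_le_visits y z P f n : branch (fun=> None) y P f ->
  run 0 (hits y z) y n f <= (z \in P)%:R +
  \sum_(t < n) walk_sum G t.+1 (last y P)
    (fun s => (last (last y P) s == z)%:R * alive p P s).
Proof.
have g0 := good_empty; elim: n P f => [|n IH] P f bf.
  rewrite run0; last exact: branch_not_final bf.
  by rewrite big_ord0 addr0 ler0n.
have walk0 t u Q : 0 <= walk_sum G t u (fun s => (last u s == z)%:R * alive p Q s).
  by apply: walk_sum_ge0 => s; rewrite mulr_ge0 // alive_ge0.
rewrite runS; last exact: branch_not_final bf.
rewrite (branch_tip bf).
apply: (@le_trans _ _ (avg G (last y P) (fun v => (z \in P)%:R +
    \sum_(t < n.+1) walk_sum G t v (fun s => (last v s == z)%:R * alive p P (v :: s))))); last first.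
  rewrite avgD lerD //; first exact: avg_le.
  by rewrite avg_sum; apply: ler_sum => t _; apply: ler_avg => v _.
apply: ler_avg => v _.
have [vP|vP] := boolP (v \in P).
  have [vu pv] := branch_leads bf vP.
  rewrite topple_to_leads // pv.
  set q := loop_weight p _; set S := \sum_(t < _) _.
  have c := branch_completed g0 bf (or_introl vP).
  have h1 : run 0 (hits y z) y n (upd f (last y P) v) <= (z \in P)%:R.
    rewrite run_final; last first.
      by apply: (completed_good c); apply/(completed_dom c); right; exact: branch_a_mem bf.
    (* Any vertex reached from the final vertex y carries an arrow, and the completed state has
       arrows only on P. *)
    rewrite /hits ler_nat; case: asboolP => // yz; rewrite lt0b.
    have fy : final (upd f (last y P) v) y.
      by apply: (completed_good c); apply/(completed_dom c); right; exact: branch_a_mem bf.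
    by have [[]|] := (completed_dom c z).1 (final_Some (final_descends fy yz)).
  have h2 : (1 - q) * run 0 (hits y z) y n (clear f (drop (index v P) P)) <=
      (1 - q) * (z \in P)%:R + S.
    apply: (le_trans (ler_wpM2l _ (IH _ _ (branch_clear g0 bf vP)))).
      exact: loop_weight_le1.
    rewrite mulrDr lerD //.
      rewrite ler_wpM2l ?loop_weight_le1 // ler_nat.
      by case: (boolP (z \in take _ _)) => // /mem_take ->.
    rewrite branch_last_take // /S big_ord_recl ler_wpDl //.
      by apply: walk_sum_ge0 => s; rewrite mulr_ge0 // alive_ge0.
    rewrite mulr_sumr; apply: ler_sum => t _.
    rewrite -walk_sumZ lift0; apply: ler_walk_sum => s _ _.
    by rewrite [alive p P _]/= vP /= mulrCA.
  apply: (@le_trans _ _ (q * (z \in P)%:R + ((1 - q) * (z \in P)%:R + S))).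
    by rewrite lerD // ler_wpM2l ?loop_weight_ge0.
  by rewrite addrA -mulrDl subrKC mul1r.
rewrite topple_to_fresh; last exact: (branch_not_leads g0 bf vP).
apply: (le_trans (IH _ _ (branch_extend g0 bf vP erefl))).
rewrite last_rcons mem_rcons inE big_ord_recl addrA lerD //.
  rewrite /= vP mulr1 -natrD ler_nat [z == v]eq_sym.
  by case: eqP => _ //=; case: (z \in P).
by apply: ler_sum => t _; rewrite lift0; apply: ler_walk_sum => s _ _; rewrite /= vP.
Qed.

(** The start is read as a first letter from the empty path, so that the word y :: s can be reversed
    as a whole. *)
Lemma reach_empty_le y z n : run 0 (hits y z) y n (fun=> None) <=
  \sum_(t < n.+1) walk_sum G t y (fun s => (last y s == z)%:R * alive_sup p (y :: s)).
Proof.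
have b0 : branch (fun=> None) y [:: y] (fun=> None) by exact: branch0.
apply: (le_trans (reach_le_visits z n b0)).
rewrite big_ord_recl lerD //.
  rewrite /= inE [z == y]eq_sym; case: eqP => _; last by rewrite mul0r.
  by rewrite mul1r (le_trans _ (alive_le_sup p01 [::] [:: y])).
apply: ler_sum => t _; rewrite lift0; apply: ler_walk_sum => s _ _.
by rewrite ler_wpM2l ?ler0n // (alive_le_sup p01 [::] (y :: s)).
Qed.

End Run.

(** * Consequences of the uniform loop assumption *)

Section LoopAssumption.
Variables (R : realType) (V : choiceType) (G : lfgraph V) (p : ocycle G -> R).
Hypothesis p01 : forall c, 0 <= p c <= 1.
Hypothesis V_infinite : infinite_set [set: V].
Hypothesis G_connected : connected_graph G.
Hypothesis ula : uniform_loop_assumption p.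
Implicit Types (x y z v : V) (s : seq V).

Lemma deg_gt0 x : (0 < deg G x)%N.
Proof.
have [y yx] : exists y, y != x.
  apply: contrapT => h; apply: V_infinite; apply: (sub_finite_set _ (finite_set1 x)).
  by move=> y _ /=; apply: contrapT => /eqP yx; apply: h; exists y.
have [[|u s] ps l] := G_connected x y; first by move: yx; rewrite -l eqxx.
move: ps => /= /andP[xu _]; rewrite /deg cardfs_gt0; apply/fset0Pn; exists u.
by rewrite -[_ \in _]/(u \in nbrs G x) mem_nbrs.
Qed.

Lemma killing_exhaustion : exists (delta : R) (L : nat) (B : V -> nat -> {fset V}),
  [/\ 0 < delta <= 1,
      forall x n, (0 < n)%N -> x \in B x n,
      forall x n, (0 < n)%N -> (B x n `<=` B x n.+1)%fset,
      forall x y, exists2 n, (0 < n)%N & y \in B x n &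
      forall x n v, (0 < n)%N -> v \in bdry G (B x n) ->
        killing G (alive_sup p) delta L v /\
        killing G (fun s => alive_sup p (rev s)) delta L v].
Proof.
have [alpha [beta [_ [_ [_ [_ [Gamma [B [[a0 b0 _ _ _] hB hG hloop _]]]]]]]]] := ula.
(* Truncation at 1 ensures that the killing probability [be ^+ 2 * al] is at most 1. *)
pose al := Num.min alpha 1; pose be := Num.min beta 1.
have al0 : 0 < al <= 1 by rewrite lt_min a0 ltr01 ge_min lexx orbT.
have be0 : 0 < be <= 1 by rewrite lt_min b0 ltr01 ge_min lexx orbT.
have [a1 a2] := andP al0; have [b1 b2] := andP be0.
have [K Kb] : exists K, 2^-1 ^+ K <= be.
  have h : (fun k => (2^-1 : R) ^+ k) @ \oo --> (0 : R).
    by apply: cvg_expr; rewrite ger0_norm ?invr_ge0 // invf_lt1 // ltr1n.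
  move/cvgrPdist_le : h => /(_ be b1)[k _ kP]; exists k.
  have := kP k (leqnn k); rewrite /= sub0r normrN; exact: le_trans (ler_norm _).
(* The double turn has probability at least [be ^+ 2] and survival weight at most [1 - al]; its
   length is at most 2K + 1. *)
exists (be ^+ 2 * al), K.*2.+1, B; split.
- have [/ltW b3 /ltW a3] := (b1, a1).
  by rewrite mulr_gt0 ?exprn_gt0 //= mulr_ile1 ?exprn_ge0 ?exprn_ile1.
- by move=> x n n0; have [h _ _] := hB x; exact: (h n n0).1.
- by move=> x; have [] := hB x.
- by move=> x; have [] := hB x.
move=> x n v n0 vB; have [c [s [Gc sc _ hs]]] := hloop x n v n0 vB.
have pc : al <= p c by apply: (@le_trans _ _ alpha); [rewrite ge_min lexx|case/andP: (hG c Gc)].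
have hs' : be < srw_prob R G v (close_seq s) by apply: le_lt_trans hs; rewrite ge_min lexx.
have [w [w0 wK w1 w2 wa]] := double_loop_word p01 be0 Kb pc sc hs'.
have e : 1 - be ^+ 2 * (1 - (1 - al)) = 1 - be ^+ 2 * al by ring.
split; exists (size w); split=> //; rewrite -e.
  by apply: walk_sum_word_le => //; rewrite ?exprn_gt0 ?gerBl ?ltW // => s'; exact: alive_sup_le1.
rewrite -(size_rev w); apply: walk_sum_word_le => //.
- by rewrite exprn_gt0.
- by rewrite gerBl ltW.
- by move=> s'; exact: alive_sup_le1.
- by rewrite revK.
Qed.

Lemma alive_sup_rev_cat s s' :
  alive_sup p (rev (s ++ s')) <= alive_sup p (rev s) * alive_sup p (rev s').
Proof. by rewrite rev_cat mulrC alive_sup_cat. Qed.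

Lemma survival_cvg0 x : walk_sum G t x (alive_sup p) @[t --> \oo] --> (0 : R).
Proof.
have [delta [L [B [d01 hx _ _ kB]]]] := killing_exhaustion.
apply: (surv_cvg0 (alive_sup_ge0 p01) (alive_sup_le1 p01) (alive_sup_cat p01) d01) => //.
by move=> y; exists (B y 1%N); split=> [|v vB]; [exact: hx|exact: (kB y 1%N v isT vB).1].
Qed.

Lemma sum_reach_small z e : 0 < e -> exists2 K : {fset V}, z \in K &
  \sum_(y <- bdry G K) reach_lim p y z (fun=> None) <= e.
Proof.
move=> e0; have [delta [L [B [d01 hx incr exh kB]]]] := killing_exhaustion.
have dz : 0 < (deg G z)%:R :> R by rewrite ltr0n deg_gt0.
have [n n0 small] := green_small (fun s => alive_sup_ge0 p01 (rev s))
  (fun s => alive_sup_le1 p01 (rev s)) alive_sup_rev_cat d01 (incr z) (exh z)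
  (fun n v n0 vB => (kB z n v n0 vB).2) z (divr_gt0 e0 dz).
exists (B z n); first exact: hx.
have cv : (\sum_(y <- bdry G (B z n)) run p 0 (hits R y z) y N (fun=> None))
    @[N --> \oo] --> \sum_(y <- bdry G (B z n)) reach_lim p y z (fun=> None).
  elim: (enum_fset _) => [|y r IH].
    under eq_fun do rewrite big_nil; rewrite big_nil; exact: cvg_cst.
  under eq_fun do rewrite big_cons; rewrite big_cons.
  by apply: cvgD => //; exact: reach_cvg.
apply: (ler_cvg_to cv (cvg_cst e)); near=> N.
apply: (@le_trans _ _ (\sum_(y <- bdry G (B z n)) \sum_(t < N.+1)
    (deg G z)%:R * walk_sum G t z (fun s =>
      (last z s == y)%:R * alive_sup p (rev s)))).
  apply: ler_sum => y _; apply: (le_trans (reach_empty_le p01 y z N)).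
  apply: ler_sum => t _.
  have := walk_sum_rev t (alive_sup p) (deg_gt0 y) (deg_gt0 z).
  (* The degree of y is at least 1; it is inserted to make the reversal applicable. *)
  set A := walk_sum G t y _ => rv; apply: (@le_trans _ _ ((deg G y)%:R * A)).
    rewrite ler_peMl ?ler1n ?deg_gt0 //; apply: walk_sum_ge0 => s.
    by rewrite mulr_ge0 // alive_sup_ge0.
  rewrite rv ler_wpM2l //; apply: ler_walk_sum => s _ _; rewrite ler_wpM2l //.
  (* The reversed word ends with the letter z, and dropping it can only increase the weight. *)
  rewrite rev_cons -cats1 (le_trans (alive_sup_cat p01 _ _)) //.
  by rewrite ler_piMr ?alive_sup_ge0 ?alive_sup_le1.
rewrite exchange_big /=.
apply: (@le_trans _ _ ((deg G z)%:R *
    green G (fun s => alive_sup p (rev s)) (bdry G (B z n)) N.+1 z)).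
  rewrite /green mulr_sumr; apply: ler_sum => t _.
  rewrite -mulr_sumr ler_wpM2l // -walk_sum_sum; apply: ler_walk_sum => s _ _.
  rewrite -mulr_suml ler_wpM2r ?alive_sup_ge0 //.
  have [ls|ls] := boolP (last z s \in bdry G (B z n)).
    rewrite (bigD1_seq (last z s)) ?fset_uniq //= eqxx big1 ?addr0 // => y.
    by rewrite eq_sym => /negbTE->.
  rewrite big_seq big1 // => y yB; case: eqP => // e1.
  by move: ls; rewrite e1 yB.
by rewrite mulrC -ler_pdivlMr.
Unshelve. all: by end_near.
Qed.

End LoopAssumption.
(** * States of Wilson's algorithm *)

Section Process.
Variables (R : realType) (V : choiceType) (G : lfgraph V) (p : ocycle G -> R).
Implicit Types (f g h : V -> option V) (x y z u v w a : V) (P s : seq V).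

(** One outcome of [topple_to]. The strict inequality is complementary to the rule of [lerw_step],
    which keeps a loop when y is at most its weight. *)
Definition step_to u v (y : R) f : V -> option V :=
  if `[< leads f v u >] && (loop_weight p (pth f v) < y) then clear f (pth f v)
  else upd f u v.

(* From the state f at time m, the walk from a stops in the state g. *)
Inductive completes a (X : nat -> V) (Y : nat -> R) :
    nat -> (V -> option V) -> (V -> option V) -> Prop :=
| completes_final m f of final f a : completes a X Y m f f
| completes_step m f g of ~ final f a &
    completes a X Y m.+1 (step_to (X m) (X m.+1) (Y m.+1) f) g :
    completes a X Y m f g.

(** A relation rather than a function: no state results when some walk never stops. *)
Inductive builds (X : V -> nat -> V) (Y : V -> nat -> R) :
    seq V -> (V -> option V) -> (V -> option V) -> Prop :=
| builds_nil f : builds X Y [::] f f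
| builds_cons a l f g h of completes a (X a) (Y a) 0 f g & builds X Y l g h :
    builds X Y (a :: l) f h.

Lemma completes_end a X Y m f g : completes a X Y m f g -> final g a.
Proof. by elim. Qed.

Lemma completes_fun a X Y m f g h :
  completes a X Y m f g -> completes a X Y m f h -> g = h.
Proof.
move=> c; elim: c h => [{}m {}f fa|{}m {}f {}g fa _ IH] h d.
  by case: d fa.
by case: d fa IH => [? ? //|? ? ? _ d _]; exact.
Qed.

Lemma builds_fun X Y l f g h : builds X Y l f g -> builds X Y l f h -> g = h.
Proof.
move=> b; elim: b h => [{}f|a {}l {}f {}g k c _ IH] h d.
  by inversion d.
inversion d as [|a' l' f' g' h' c' d']; subst.
by apply: IH; rewrite (completes_fun c c').
Qed.

Lemma builds_rcons X Y l a f h : builds X Y (rcons l a) f h <->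
  exists2 g, builds X Y l f g & completes a (X a) (Y a) 0 g h.
Proof.
split.
  elim: l f => [|b l IH] f d; inversion d as [|a' l' f' g' h' c' d']; subst.
    by exists f; [exact: builds_nil|inversion d'; subst].
  by have [g bg ch] := IH _ d'; exists g => //; apply: builds_cons c' bg.
case=> g b; elim: b => [{}f|b {}l {}f {}g k c _ IH] d.
  by apply: builds_cons d _; exact: builds_nil.
by apply: builds_cons c _; exact: IH.
Qed.

Definition ptr_edge f : set {fset V} :=
  [set e | exists x y, f x = Some y /\ e = [fset x; y]%fset].

Lemma path_edges_ptr f x s : path (points f) x s -> path_edges (x :: s) `<=` ptr_edge f.
Proof.
elim: s x => [|y s IH] x /=; first by move=> _ e [].
move=> /andP[/eqP xy ps] e [uv + <-].
rewrite -[[set` _] uv]/(is_true (uv \in (x, y) :: zip (y :: s) s)) inE => /orP[/eqP->|uvs].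
  by exists x, y.
by apply: (IH y) => //; exists uv.
Qed.

Section Frozen.
Variables (X : nat -> V) (Y : nat -> R) (W : set V).
Notation lw := (lerw p X Y W).
Notation stopped := (lerw_stopped p X Y W).

Lemma lerw_frozen n m : stopped n -> (n <= m)%N -> stopped m /\ lw m = lw n.
Proof.
move=> sn /subnKC <-; elim: (m - n)%N => [|k [sk ek]]; first by rewrite addn0.
have e : lw (n + k.+1)%N = lw (n + k)%N.
  rewrite addnS /=; case: ifPn => //; rewrite negb_or => /andP[h1 /asboolPn h2].
  by case: sk => //; rewrite (negbTE h1).
rewrite e ek; split=> //; case: sk => [h|[j jk Wj]].
  by left; rewrite e.
by right; exists j => //; rewrite addnS leqW.
Qed.

Lemma lerw_stopped_eq n m : stopped n -> stopped m -> lw n = lw m.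
Proof.
move=> sn sm; have [nm|/ltnW mn] := leqP n m.
  by rewrite (lerw_frozen sn nm).2.
by rewrite (lerw_frozen sm mn).2.
Qed.

Lemma lerw_vertices_stopped n : stopped n ->
  lerw_vertices p X Y W = state_vertices (lw n).
Proof.
move=> sn; apply/seteqP; split=> [x [m sm]|x xs]; last by exists n.
by rewrite (lerw_stopped_eq sm sn).
Qed.

Lemma lerw_edges_stopped n : stopped n -> lerw_edges p X Y W = state_edges (lw n).
Proof.
move=> sn; apply/seteqP; split=> [x [m sm]|x xs]; last by exists n.
by rewrite (lerw_stopped_eq sm sn).
Qed.

End Frozen.

(** * Coupling of pointer states with the loop-erased walk *)

Section Simulation.
Variables (X : nat -> V) (Y : nat -> R) (f0 : V -> option V).
Hypothesis g0 : good f0.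
Let W : set V := [set x | f0 x <> None].
Notation lw := (lerw p X Y W).
Notation stopped := (lerw_stopped p X Y W).

(** The vertex sets must agree exactly, being the boundary condition of the next walk. For the edges
    an inclusion is enough to bound components from above. *)
Definition simulated g := exists P, [/\ completed f0 P g,
  W `|` lerw_vertices p X Y W = [set x | g x <> None] &
  lerw_edges p X Y W `<=` ptr_edge g].

(** As long as the walk runs, its current path is the branch of a: appending a vertex adds an arrow,
    erasing a loop clears its arrows. A walk stopped by hitting W has one more vertex than P, but
    that vertex is in W. *)
Lemma completes_simulated a m P f g : branch f0 a P f -> X m = last a P ->
  lw m = (P, None) -> ~ hit_by X W m -> completes a X Y m f g -> simulated g.
Proof.
move=> + + + + c; elim: c P => [{}m {}f fa|{}m {}f {}g nf c IH] P bf Xm lm nh.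
  by case: (branch_not_final bf).
set v := X m.+1; set y := Y m.+1.
have lS : lw m.+1 = lerw_step p P v y by rewrite /= lm asboolF.
have [s eP es] := branch_ends bf; have l : last a s = last a P by rewrite eP.
have fu := branch_tip_None bf.
have pu : path (points (upd f (last a P) v)) a s by exact: path_upd_last.
have hitS : ~ W v -> ~ hit_by X W m.+1.
  move=> nv [k]; rewrite leq_eqVlt => /orP[/eqP->//|km Wk].
  by apply: nh; exists k.
have fin : completed f0 P (upd f (last a P) v) -> stopped m.+1 ->
    [set` (lw m.+1).1] `<=` W `|` [set` P] -> [set` P] `<=` [set` (lw m.+1).1] ->
    state_edges (lw m.+1) `<=` ptr_edge (upd f (last a P) v) ->
    completes a X Y m.+1 (upd f (last a P) v) g -> simulated g.
  move=> cp sm s1 s2 se cg.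
  have fa : final (upd f (last a P) v) a.
    by apply: (completed_good cp); apply/(completed_dom cp); right; exact: branch_a_mem bf.
  rewrite -(completes_fun (completes_final _ _ _ fa) cg); exists P; split=> //.
    rewrite (lerw_vertices_stopped sm); apply/seteqP; split=> x.
      by move=> xs; apply/(completed_dom cp); case: xs => [|/s1[]]; [left|left|right].
    by move=> /(completed_dom cp)[|/s2]; [left|right].
  by rewrite (lerw_edges_stopped sm).
have [vP|vP] := boolP (v \in P).
  have [vu pv] := branch_leads bf vP.
  have f0v : f0 v = None by exact: branch_mem_None bf _ vP.
  move: c IH; rewrite Xm -/v -/y /step_to asboolT // andTb pv; case: ltP => hy c IH.
    apply: (IH (take (index v P).+1 P)); rewrite ?branch_last_take //.
    - exact: branch_clear.
    - by rewrite lS /lerw_step vP /= leNgt hy.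
    - exact: hitS.
  have e : lw m.+1 = (P, Some (close_seq (drop (index v P) P))).
    by rewrite lS /lerw_step vP /= hy.
  have sm : stopped m.+1 by left; rewrite e.
  apply: (fin (branch_completed g0 bf (or_introl vP)) sm _ _ _ c); rewrite e.
  - by move=> x xP; right.
  - by [].
  have [s2 [dr es2 l2]] := branch_mem_ends bf vP; rewrite dr /= => b [|].
    by rewrite [X in path_edges X]eP; exact: path_edges_ptr.
  apply: path_edges_ptr; rewrite rcons_path path_upd_last //= l2.
  by rewrite /points upd_eq.
have nl := branch_not_leads g0 bf vP.
move: c IH; rewrite Xm -/v -/y /step_to asboolF // andFb => c IH.
have e : lw m.+1 = (rcons P v, None) by rewrite lS /lerw_step vP.
have [f0v|f0v] := pselect (f0 v = None).
  apply: (IH (rcons P v)); rewrite ?last_rcons //; first exact: branch_extend.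
  exact: hitS.
have sm : stopped m.+1 by right; exists m.+1.
apply: (fin (branch_completed g0 bf (or_intror f0v)) sm _ _ _ c); rewrite e.
- by move=> x /=; rewrite mem_rcons inE => /orP[/eqP->|]; [left|right].
- by move=> x /= xP; rewrite mem_rcons inE xP orbT.
move=> b [|//]; rewrite [X in path_edges (rcons X _)]eP; apply: path_edges_ptr.
by rewrite rcons_path pu /= l /points upd_eq.
Qed.

Lemma phase_simulated g : completes (X 0%N) X Y 0 f0 g -> simulated g.
Proof.
have [fa|fa] := pselect (f0 (X 0%N) = None).
  apply: (@completes_simulated _ _ [:: X 0%N]) => //; first exact: branch0.
  by move=> [k]; rewrite leqn0 => /eqP->.
(* The start already belongs to the forest: the walk stops at time 0 and the new branch is empty. *)
move=> c; rewrite -(completes_fun (completes_final _ _ _ (g0 fa)) c).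
have st : stopped 0 by right; exists 0%N.
exists [::]; split.
- by split=> // x; split=> [|[]]; first by left.
- rewrite (lerw_vertices_stopped st) /=; apply/seteqP; split=> x; last by left.
  by case=> // xs; have : x \in [:: X 0%N] := xs; rewrite inE => /eqP->.
- by rewrite (lerw_edges_stopped st) => b [[]|].
Qed.

End Simulation.

(** * Finiteness of components for a fixed realization *)

Section Wilson.
Variables (v : nat -> V) (X : V -> nat -> V) (Y : V -> nat -> R).
Hypothesis X0 : forall x, X x 0%N = x.
Notation first n := [seq v i | i <- iota 0 n].
Notation empty := (fun=> None).

Lemma builds_succ n h : builds X Y (first n.+1) empty h <->
  exists2 g, builds X Y (first n) empty g & completes (v n) (X (v n)) (Y (v n)) 0 g h.
Proof. by rewrite -addn1 iotaD map_cat /= cats1; exact: builds_rcons. Qed.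

Lemma wilson_builds n g : builds X Y (first n) empty g ->
  [/\ good g, finite_set [set x | g x <> None],
      (wilson p v X Y n).1 = [set x | g x <> None] &
      (wilson p v X Y n).2 `<=` ptr_edge g].
Proof.
elim: n g => [|n IH] g.
  move=> b; inversion b; subst; split=> //.
    by apply: (sub_finite_set _ (finite_set0 V)) => x /=.
  by apply/seteqP; split=> x.
move=> /builds_succ[h /IH[gh fh w1 w2] c]; rewrite /= w1.
have c' := c; rewrite -{1}(X0 (v n)) in c'.
have [P [cP dom edg]] := phase_simulated gh c'.
split=> //; first exact: completed_good cP.
  apply: (sub_finite_set _ (_ : finite_set ([set x | h x <> None] `|` [set` P]))).
    by move=> x /(completed_dom cP).
  by rewrite finite_setU; split=> //; exact: finite_seq.
move=> e [/w2[x [y [xy ->]]]|]; last exact: edg.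
by exists x, y; split=> //; rewrite (completed_ext cP) ?xy.
Qed.

Lemma builds_ext n g h : builds X Y (first n) empty g ->
  builds X Y (first n.+1) empty h -> forall x, g x <> None -> h x = g x.
Proof.
move=> b /builds_succ[g' b' c]; rewrite -(builds_fun b b') in c.
have [gg _ _ _] := wilson_builds b.
have c' := c; rewrite -{1}(X0 (v n)) in c'.
by have [P [cP _ _]] := phase_simulated gg c'; exact: completed_ext cP.
Qed.

Hypothesis X_adj : forall x m, adj G (X x m) (X x m.+1).

Lemma completes_adj a m f g : completes a (X a) (Y a) m f g ->
  (forall x y, f x = Some y -> adj G x y) -> forall x y, g x = Some y -> adj G x y.
Proof.
elim=> // {}m {}f {}g _ _ IH h; apply: IH => x y; rewrite /step_to.
case: ifP => _; first by rewrite /clear; case: ifP => // _; exact: h.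
by rewrite /upd; case: eqP => [-> [<-]|_]; [exact: X_adj|exact: h].
Qed.

Lemma builds_adj n g : builds X Y (first n) empty g ->
  forall x y, g x = Some y -> adj G x y.
Proof.
elim: n g => [|n IH] g; first by move=> b; inversion b.
by move=> /builds_succ[h /IH hadj c]; exact: completes_adj c hadj.
Qed.

Section Components.
Hypothesis v_bij : bijective v.
Hypothesis all_stop : forall n, exists g, builds X Y (first n) empty g.
Hypothesis few_ancestors : forall z, exists2 K : {fset V}, z \in K &
  forall n g, builds X Y (first n.+1) empty g -> v n \in bdry G K -> ~ descends g (v n) z.

Let S n := projT1 (cid (all_stop n)).
Let SP n : builds X Y (first n) empty (S n) := projT2 (cid (all_stop n)).

Let S_ext n m x : (n <= m)%N -> S n x <> None -> S m x = S n x.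
Proof.
move=> /subnKC <- sx; elim: (m - n)%N => [|k IH]; first by rewrite addn0.
by rewrite addnS -IH; apply: (builds_ext (SP _) (SP _)); rewrite IH.
Qed.

Let S_good n : good (S n). Proof. by have [] := wilson_builds (SP n). Qed.

Let S_dom n : S n.+1 (v n) <> None.
Proof. by have [g _ c] := (builds_succ _ _).1 (SP n.+1); exact: final_Some (completes_end c). Qed.

Let S_descends n m x z : (n <= m)%N -> S n x <> None ->
  descends (S m) x z <-> descends (S n) x z.
Proof.
move=> nm sx; apply: transfer_descends => y xy.
rewrite (S_ext nm) //; apply: final_Some.
by apply: final_descends xy; exact: S_good.
Qed.

Let S_descends_mono n m x z : (n <= m)%N -> descends (S n) x z -> descends (S m) x z.
Proof.
move=> nm [s ps l]; exists s => //; elim: s x ps {l} => //= y s IH x /andP[/eqP xy ps].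
by rewrite IH // andbT /points (S_ext nm) ?xy.
Qed.

Let ancestors z : set V := [set y | exists n, descends (S n) y z].

Let finite_ancestors z : finite_set (ancestors z).
Proof.
have [K zK hK] := few_ancestors z.
apply: (sub_finite_set _ (finite_fset K)) => y [n [s ps l]] /=.
apply: contrapT => /negP yK.
(* On the way from y outside K to z in K, the first vertex of K is preceded by a neighbour outside
   K, so it lies on the boundary. *)
have [w [wK dw]] : exists w, w \in bdry G K /\ descends (S n) w z.
  elim: s y ps l yK => [|u s IH] y /=; first by move=> _ ->; rewrite zK.
  move=> /andP[/eqP yu ps] l yK; have [uK|uK] := boolP (u \in K); last exact: IH uK.
  exists u; split; last by exists s.
  rewrite !inE uK /=; apply/asboolP; exists y => //.
  by rewrite adj_sym; exact: builds_adj (SP n) _ _ yu.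
have [v' vK v'K] := v_bij.
apply: (hK _ _ (SP (v' w).+1)); rewrite v'K //.
have sw : S (v' w).+1 w <> None by have := @S_dom (v' w); rewrite v'K.
have [nm|mn] := leqP n (v' w).+1; first exact: S_descends_mono nm dw.
exact/(S_descends _ (ltnW mn) sw).
Qed.

Let meet n x y := exists z, descends (S n) x z /\ descends (S n) y z.

(** The two paths leaving y are comparable, so one meeting point descends to the other. *)
Let meet_trans n x y w : meet n x y -> meet n y w -> meet n x w.
Proof.
move=> [z1 [x1 y1]] [z2 [y2 w2]].
have [h|h] : descends (S n) z1 z2 \/ descends (S n) z2 z1.
  case: y1 y2 => [s1 p1 <-] [s2 p2 <-].
  have [le|/ltnW le] := leqP (size s1) (size s2).
    have [s e] := points_prefix p1 p2 le; left; exists s; last by rewrite e last_cat.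
    by move: p2; rewrite e cat_path => /andP[].
  have [s e] := points_prefix p2 p1 le; right; exists s; last by rewrite e last_cat.
  by move: p1; rewrite e cat_path => /andP[].
- by exists z2; split=> //; exact: descends_trans x1 h.
- by exists z1; split=> //; exact: descends_trans w2 h.
Qed.

Let meet_mono n m x y : (n <= m)%N -> meet n x y -> meet m x y.
Proof. by move=> nm [z [xz yz]]; exists z; split; exact: S_descends_mono nm _. Qed.

(** An open edge carries an arrow in one of its directions, so the branches of its two ends meet. *)
Let component_meet x y : component (G := G) (wilson_config p v X Y) x y ->
  exists n, meet n x y.
Proof.
case=> s; elim: s x => [|u s IH] x /=.
  by move=> _ <-; exists 0%N, x; split; exact: descends_refl.
move=> /andP[/asboolP[e eE /asboolP[n we]] ps] l.
have [_ _ _ sub] := wilson_builds (SP n).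
have [a [b [ab eab]]] := sub _ we; have [m mm] := IH u ps l.
exists (maxn n m); apply: meet_trans (meet_mono (leq_maxr n m) mm).
apply: (meet_mono (leq_maxl n m)).
have dab : meet n a b by exists b; split; [exact: descends_points|exact: descends_refl].
have dba : meet n b a by exists b; split; [exact: descends_refl|exact: descends_points].
have E : [fset x; u]%fset = [fset a; b]%fset by rewrite -eE.
have : x \in [fset a; b]%fset by rewrite -E !inE eqxx.
have : u \in [fset a; b]%fset by rewrite -E !inE eqxx orbT.
have : a \in [fset x; u]%fset by rewrite E !inE eqxx.
have : b \in [fset x; u]%fset by rewrite E !inE eqxx orbT.
rewrite !inE.
move=> bxu axu; move=> /orP[/eqP ua|/eqP ub] /orP[/eqP xa|/eqP xb]; subst => //.
- by exists a; split; exact: descends_refl.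
- by exists b; split; exact: descends_refl.
Qed.

(** Every vertex of the component is an ancestor of some descendant of x. These descendants are
    finitely many, as they all carry arrows of the finite state obtained once the branch of x is
    built. *)
Lemma finite_components x : finite_set (component (G := G) (wilson_config p v X Y) x).
Proof.
have [v' vK v'K] := v_bij; set k := (v' x).+1.
have sx : S k x <> None by have := @S_dom (v' x); rewrite v'K.
have D : finite_set [set z | descends (S k) x z].
  have [_ fin _ _] := wilson_builds (SP k); apply: sub_finite_set fin => z xz /=.
  by apply: final_Some; apply: final_descends xz; exact: S_good.
apply: (sub_finite_set _ (bigcup_finite D (fun z _ => finite_ancestors z))).
move=> y /component_meet[n [z [xz yz]]]; exists z; last by exists n.
have [kn|nk] := leqP k n; first exact/(S_descends _ kn sx).
exact: S_descends_mono (ltnW nk) xz.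
Qed.

End Components.
End Wilson.
End Process.
(** * Probabilities *)

Section Driving.
Variables (R : realType) (V : choiceType) (G : lfgraph V) (p : ocycle G -> R).
Variables (d : measure_display) (T : measurableType d) (P : probability T R).
Variables (X : V -> nat -> T -> V) (Y : V -> nat -> {RV P >-> R}).
Hypothesis drv : driving_families G X Y.
Implicit Types (a u v x y : V) (t : T) (D l : seq V) (C : set R).
Implicit Types (H : V -> seq (V * set R)).

Definition unif C : R := fine (uniform_prob (@ltr01 R) C).

Lemma unif_ge0 C : 0 <= unif C.
Proof. exact: fine_ge0. Qed.

Lemma unifT : unif setT = 1.
Proof. by rewrite /unif /uniform_prob integral_uniform_pdf1. Qed.

Lemma unif_le q : 0 <= q <= 1 -> unif [set y | y <= q] = q.
Proof.
move=> /andP[q0 q1]; rewrite /unif /uniform_prob integral_uniform_pdf.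
have -> : [set y | y <= q] `&` `[0, 1]%classic = `[0, q]%classic.
  apply/seteqP; split=> x /=; rewrite !in_itv /= => h; first by case: h => -> /andP[->].
  by case/andP: h => x0 xq; rewrite xq x0 (le_trans xq).
rewrite (eq_integral (fun=> 1%:E)); last first.
  move=> x; rewrite inE /= in_itv /= => /andP[x0 xq].
  by rewrite /uniform_pdf x0 (le_trans xq) //= subr0 invr1.
rewrite integral_cst //= lebesgue_measure_itv /= mul1e lte_fin.
by move: q0; rewrite le_eqVlt => /orP[/eqP<-|q0]; rewrite ?ltxx // q0 /= subr0.
Qed.

Lemma measurable_le_set (q : R) : measurable [set y : R | y <= q].
Proof.
by rewrite (_ : [set y | y <= q] = `]-oo, q]%classic) //; apply/seteqP; split=> x /=; rewrite in_itv.
Qed.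

Lemma measurable_gt_set (q : R) : measurable [set y : R | q < y].
Proof.
rewrite (_ : [set y | q < y] = `]q, +oo[%classic) //.
by apply/seteqP; split=> x /=; rewrite in_itv /= andbT.
Qed.

Lemma unif_gt q : 0 <= q <= 1 -> unif [set y | q < y] = 1 - q.
Proof.
move=> q01; have -> : [set y | q < y] = ~` [set y | y <= q].
  by apply/seteqP; split=> x /=; rewrite ltNge => /negP.
rewrite /unif probability_setC; last exact: measurable_le_set.
rewrite fineB //; last by rewrite fin_num_measure //; exact: measurable_le_set.
by congr (_ - _); exact: unif_le.
Qed.

Lemma uniform_preimage a n C : measurable C -> P (Y a n @^-1` C) = (unif C)%:E.
Proof.
move=> mC; case: drv => _ /(_ a)[/(_ n C mC) e _] _.
rewrite -[LHS]/(distribution P (Y a n) C) e fineK //; exact: fin_num_measure.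
Qed.

(* A history H records, for each walk, the positions and the sets in which the
   uniform variables fall, from time 1 on. *)
Definition walk_event H a : set T :=
  [set t | X a 0%N t = a /\ [seq X a i t | i <- iota 1 (size (H a))] = unzip1 (H a)].

Definition unif_event H a : set T :=
  [set t | forall i, (i < size (H a))%N -> (nth (a, setT) (H a) i).2 (Y a i.+1 t)].

Definition history_event D H : set T :=
  [set t | forall a, a \in D -> walk_event H a t /\ unif_event H a t].

Definition history_weight D H : R :=
  \prod_(a <- D) (srw_prob R G a (unzip1 (H a)) * \prod_(c <- H a) unif c.2).

Definition measurable_history H := forall a i, measurable (nth (a, setT) (H a) i).2.

Lemma measurable_bounded_forall d' (S : measurableType d') n (A : nat -> set S) :
  (forall i, (i < n)%N -> measurable (A i)) ->
  measurable [set t | forall i, (i < n)%N -> A i t].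
Proof.
move=> mA; rewrite (_ : [set _ | _] = \bigcap_i (if (i < n)%N then A i else setT)).
  by apply: bigcapT_measurable => i; case: ifP => // /mA.
apply/seteqP; split=> t /= h i; first by move=> _; case: ifP => // /h.
by move=> iN; have := h i I; rewrite iN.
Qed.

Lemma walk_eventE H a : walk_event H a = [set t | X a 0%N t = a] `&`
  [set t | forall i, (i < size (H a))%N -> X a i.+1 t = (nth (a, setT) (H a) i).1].
Proof.
apply/seteqP; split=> t /= [X0 h]; split=> //.
  move=> i iH; have := congr1 (fun s => nth a s i) h.
  by rewrite (nth_map 0%N) ?size_iota // nth_iota // add1n (nth_map (a, setT)).
apply: (@eq_from_nth _ a) => [|i]; rewrite !size_map size_iota // => iH.
by rewrite (nth_map 0%N) ?size_iota // nth_iota // add1n h // (nth_map (a, setT)).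
Qed.

Lemma walk_event_sigma H a : sigma_process [set: set V] (X a) (walk_event H a).
Proof.
pose GX := \bigcup_n preimage_set_system [set: T] (X a n) [set: set V].
have m1 n y : @measurable _ (g_sigma_algebraType GX) [set t | X a n t = y].
  apply: sub_sigma_algebra; exists n => //; exists [set y] => //.
  by rewrite setTI.
suff: @measurable _ (g_sigma_algebraType GX) (walk_event H a) by [].
rewrite walk_eventE; apply: measurableI; first exact: m1.
by apply: measurable_bounded_forall => i _; exact: m1.
Qed.

Lemma unif_event_sigma H a : measurable_history H ->
  sigma_process measurable (fun n => Y a n : T -> R) (unif_event H a).
Proof.
move=> mH; pose GY := \bigcup_n preimage_set_system [set: T] (Y a n : T -> R) measurable.
suff: @measurable _ (g_sigma_algebraType GY) (unif_event H a) by [].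
apply: measurable_bounded_forall => i _.
apply: sub_sigma_algebra; exists i.+1 => //; exists (nth (a, setT) (H a) i).2 => //.
by rewrite setTI.
Qed.

Lemma measurable_walk_event H a : measurable (walk_event H a).
Proof.
case: drv => /(_ a)[mX _ _] _ _; rewrite walk_eventE; apply: measurableI => //.
by apply: measurable_bounded_forall => i _; exact: mX.
Qed.

Lemma measurable_unif_event H a : measurable_history H -> measurable (unif_event H a).
Proof.
move=> mH; apply: measurable_bounded_forall => i _.
have := measurable_funPT (Y a i.+1) measurableT _ (mH a i).
by rewrite setTI.
Qed.

Lemma prob_walk_event H a : P (walk_event H a) = (srw_prob R G a (unzip1 (H a)))%:E.
Proof.
case: drv => /(_ a)[_ _ /(_ (unzip1 (H a))) e] _ _.
by rewrite -e size_map.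
Qed.

Lemma prod_EFin (I : Type) (r : seq I) (F : I -> R) :
  (\prod_(i <- r) (F i)%:E)%E = (\prod_(i <- r) F i)%:E.
Proof.
elim: r => [|i r IH]; first by rewrite !big_nil.
by rewrite !big_cons IH EFinM.
Qed.

Lemma prob_unif_event H a : measurable_history H ->
  P (unif_event H a) = (\prod_(c <- H a) unif c.2)%:E.
Proof.
move=> mH; case: drv => _ /(_ a)[_ indep] _.
(* The uniform variables are used from time 1 on, whereas the history is a list indexed from 0. *)
pose r := iota 1 (size (H a)); pose A i := (nth (a, setT) (H a) i.-1).2.
pose J := [fset i in r]%fset.
have := indep J (fun i => Y a i @^-1` A i).
have -> : \bigcap_(i in [set` J]) (Y a i @^-1` A i) = unif_event H a.
  apply/seteqP; split=> t h i /=.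
    by move=> iH; apply: (h i.+1); rewrite /= !inE mem_iota add1n.
  rewrite !inE mem_iota => /andP[i0 iH].
  by rewrite /A; case: i i0 iH => // i _; rewrite add1n ltnS => /h.
move=> ->; last by move=> i _; exists (A i); [exact: mH|rewrite setTI].
have pJ : perm_eq J r.
  by apply: uniq_perm; rewrite ?fset_uniq ?iota_uniq // => i; rewrite !inE.
rewrite (perm_big _ pJ) /= (eq_bigr (fun i => (unif (A i))%:E)); last first.
  by move=> i _; rewrite uniform_preimage //; exact: mH.
rewrite prod_EFin /r (_ : iota 1 _ = [seq i.+1 | i <- iota 0 (size (H a))]); last first.
  by rewrite (iotaDl 1 0).
rewrite big_map [in RHS](_ : H a = [seq nth (a, setT) (H a) i | i <- iota 0 (size (H a))]).
  by rewrite big_map.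
by rewrite -/(mkseq _ _) mkseq_nth.
Qed.

Lemma measurable_history_event D H : measurable_history H ->
  measurable (history_event D H).
Proof.
move=> mH; elim: D => [|a D IH].
  by rewrite (_ : history_event _ _ = setT) //; apply/seteqP; split.
have -> : history_event (a :: D) H =
    (walk_event H a `&` unif_event H a) `&` history_event D H.
  apply/seteqP; split=> t.
    move=> h; split; first exact: h (mem_head _ _).
    by move=> b bD; apply: h; rewrite inE bD orbT.
  by case=> h1 h2 b; rewrite inE => /orP[/eqP->//|/h2].
apply: measurableI => //; apply: measurableI; first exact: measurable_walk_event.
exact: measurable_unif_event.
Qed.

Lemma prob_history_event D H : uniq D -> measurable_history H ->
  P (history_event D H) = (history_weight D H)%:E.
Proof.
move=> uD mH; case: drv => _ _ indep.
pose r : seq (V + V) := map inl D ++ map inr D; pose J := [fset i in r]%fset.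
pose A i := match i with inl a => walk_event H a | inr a => unif_event H a end.
have Jr i : (i \in J) = (i \in r) by rewrite !inE mem_cat.
have := indep J A; have -> : \bigcap_(i in [set` J]) A i = history_event D H.
  apply/seteqP; split=> t h /=.
    move=> a aD; split.
      by apply: (h (inl a)); rewrite /= Jr mem_cat map_f.
    by apply: (h (inr a)); rewrite /= Jr mem_cat (map_f inr) ?orbT.
  case=> a /=; rewrite Jr mem_cat => /orP[]/mapP[b bD] // [->].
    by have [] := h b bD.
  by have [] := h b bD.
move=> ->; last first.
  by case=> a _ /=; [exact: walk_event_sigma|exact: unif_event_sigma].
have ur : uniq r.
  rewrite cat_uniq !map_inj_uniq ?uD ?andbT //=; last by move=> ? ? [].
    by apply/hasPn => _ /mapP[b _ ->]; apply/mapP => -[].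
  by move=> ? ? [].
have pJ : perm_eq J r.
  by apply: uniq_perm; rewrite ?fset_uniq.
rewrite (perm_big _ pJ) /= big_cat !big_map /=.
under eq_bigr do rewrite prob_walk_event.
under [X in (_ * X)%E]eq_bigr do rewrite prob_unif_event //.
by rewrite !prod_EFin -EFinM -big_split.
Qed.

Lemma history_weight_ge0 D H : 0 <= history_weight D H.
Proof.
apply: prodr_ge0 => a _; rewrite mulr_ge0 ?srw_prob_ge0 //.
by apply: prodr_ge0 => c _; exact: unif_ge0.
Qed.

(** A bound on the outer measure of A, for events whose measurability is not established. *)
Definition covered (A : set T) (c : R) :=
  exists M, [/\ measurable M, A `<=` M & (P M <= c%:E)%E].

Lemma covered_sub (A B : set T) c c' : covered B c -> A `<=` B -> c <= c' -> covered A c'.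
Proof.
move=> [M [mM BM PM]] AB cc'; exists M; split=> //; first exact: subset_trans BM.
by apply: (le_trans PM); rewrite lee_fin.
Qed.

Lemma coveredU (A B : set T) c c' :
  covered A c -> covered B c' -> covered (A `|` B) (c + c').
Proof.
move=> [M [mM AM PM]] [N [mN BN PN]]; exists (M `|` N); split.
- exact: measurableU.
- exact: setUSS.
by rewrite EFinD (le_trans (measureU2 P mM mN)) // leeD.
Qed.

Lemma covered0 c : 0 <= c -> covered set0 c.
Proof. by move=> c0; exists set0; split=> //; rewrite measure0 lee_fin. Qed.

Lemma covered_sum (I : eqType) (r : seq I) (A : I -> set T) (c : I -> R) :
  (forall i, i \in r -> covered (A i) (c i)) ->
  covered [set t | exists2 i, i \in r & A i t] (\sum_(i <- r) c i).
Proof.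
elim: r => [|i r IH] h.
  by rewrite big_nil; apply: covered_sub (covered0 (lexx 0)) _ (lexx _) => t [].
rewrite big_cons; apply: covered_sub (coveredU (h i (mem_head _ _)) (IH _)) _ (lexx _).
  by move=> j jr; apply: h; rewrite inE jr orbT.
move=> t [j]; rewrite inE => /orP[/eqP->|jr] At; first by left.
by right; exists j.
Qed.

End Driving.

(** * The supermartingale inequality along the actual enumeration *)

Section Supermartingale.
Variables (R : realType) (V : choiceType) (G : lfgraph V) (p : ocycle G -> R).
Hypothesis p01 : forall c, 0 <= p c <= 1.
Variables (d : measure_display) (T : measurableType d) (P : probability T R).
Variables (X : V -> nat -> T -> V) (Y : V -> nat -> {RV P >-> R}).
Hypothesis drv : driving_families G X Y.
Hypothesis survival : forall x, walk_sum G n x (alive_sup p) @[n --> \oo] --> (0 : R).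
Implicit Types (a u v x y : V) (t : T) (D l : seq V) (C : set R) (f g : V -> option V).
Implicit Types (H : V -> seq (V * set R)).

Variable h : (V -> option V) -> R.
Hypothesis h_ge0 : forall f, 0 <= h f.
Hypothesis h_topple : forall f u, f u = None -> topple p u h f <= h f.

Definition regular : set T := [set t | forall x,
  X x 0%N t = x /\ forall m, adj G (X x m t) (X x m.+1 t)].

Definition builds_to t l f g := builds p (fun x n => X x n t) (fun x n => Y x n t) l f g.

Definition completes_to t a m f g := completes p a (X a ^~ t) (fun n => Y a n t) m f g.

(* Either the walks from l do not all stop, or they lead to a state of value at least 1. *)
Definition bad l f : set T := [set t | forall g, builds_to t l f g -> 1 <= h g].

Definition bad_from a m l f : set T :=
  [set t | forall g, completes_to t a m f g -> bad l g t].

Definition extend H a v C : V -> seq (V * set R) :=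
  fun b => if b == a then rcons (H a) (v, C) else H b.

Lemma measurable_extend H a v C :
  measurable_history H -> measurable C -> measurable_history (extend H a v C).
Proof.
move=> mH mC b i; rewrite /extend; case: eqP => [->|_]; last exact: mH.
rewrite nth_rcons; case: ifP => _; first exact: mH.
by case: ifP => _ //=; exact: measurableT.
Qed.

Lemma history_weight_extend H a v C D : a \notin D ->
  history_weight G (a :: D) (extend H a v C) =
  history_weight G (a :: D) H * (srw_step R G (last a (unzip1 (H a))) v * unif C).
Proof.
move=> aD; rewrite /history_weight !big_cons {1 2}/extend eqxx.
rewrite /unzip1 map_rcons -cats1 srw_prob_cat /= mulr1 -cats1 big_cat big_seq1 /=.
have -> : \prod_(b <- D) (srw_prob R G b (unzip1 (extend H a v C b)) *
    \prod_(c <- extend H a v C b) unif c.2) =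
    \prod_(b <- D) (srw_prob R G b (unzip1 (H b)) * \prod_(c <- H b) unif c.2).
  apply: eq_big_seq => b bD; rewrite /extend; case: eqP => // e.
  by move: aD; rewrite -e bD.
by rewrite -/(unzip1 (H a)); ring.
Qed.

Let iota_rcons n : iota 1 n.+1 = rcons (iota 1 n) n.+1.
Proof. by rewrite -{1}(addn1 n) iotaD add1n cats1. Qed.

Lemma history_event_last H a D t : history_event X Y (a :: D) H t ->
  X a (size (H a)) t = last a (unzip1 (H a)).
Proof.
move=> /(_ a (mem_head _ _))[[X0 e] _]; rewrite -e.
case: (size (H a)) => [|n] //.
by rewrite iota_rcons map_rcons last_rcons.
Qed.

Lemma history_event_extend H a D t C : history_event X Y (a :: D) H t ->
  C (Y a (size (H a)).+1 t) ->
  history_event X Y (a :: D) (extend H a (X a (size (H a)).+1 t) C) t.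
Proof.
move=> hev Ct b bD; have [w1 w2] := hev b bD.
have [e|ne] := eqVneq b a; last by rewrite /walk_event /unif_event /extend (negbTE ne).
subst b; rewrite /walk_event /unif_event /extend eqxx /=; split; last first.
  move=> i; rewrite size_rcons ltnS nth_rcons leq_eqVlt => /orP[/eqP->|iH].
    by rewrite ltnn eqxx.
  by rewrite iH; exact: w2.
case: w1 => X0 e; split=> //.
by rewrite size_rcons iota_rcons /unzip1 !map_rcons e.
Qed.

(** The probability that the branch of a is still unfinished after n topplings. *)
Let surv a n f := run p 1 (fun=> 0) a n f.

Let surv_ge0 a n f : 0 <= surv a n f.
Proof. exact: run_ge0. Qed.

(* The walk from a, now at x, either has stopped or is building its branch. *)
Definition phase_state f0 a f x := good f /\ final f a \/
  exists2 Q, branch f0 a Q f & last a Q = x.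

Lemma phase_upd f0 a f u v Q : good f0 -> branch f0 a Q f -> last a Q = u ->
  phase_state f0 a (upd f u v) v.
Proof.
move=> g0 bf l; have done_ : v \in Q \/ f0 v <> None -> phase_state f0 a (upd f u v) v.
  move=> vQ; left; have c := branch_completed g0 bf vQ; rewrite l in c.
  split; first exact: completed_good c.
  by apply: (completed_good c); apply/(completed_dom c); right; exact: branch_a_mem bf.
have [vQ|vQ] := boolP (v \in Q); first by apply: done_; left.
have [f0v|f0v] := pselect (f0 v = None); last by apply: done_; right.
right; exists (rcons Q v); last by rewrite last_rcons.
by rewrite -l; exact: branch_extend.
Qed.

Lemma phase_clear f0 a f u v Q : good f0 -> branch f0 a Q f -> last a Q = u ->
  leads f v u -> phase_state f0 a (clear f (pth f v)) v.
Proof.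
move=> g0 bf l vu; have vQ : v \in Q.
  by apply: contrapT => /negP vQ; apply: (branch_not_leads g0 bf vQ); rewrite l.
right; exists (take (index v Q).+1 Q); last by rewrite branch_last_take.
by rewrite (branch_leads bf vQ).2; exact: branch_clear.
Qed.

(** One phase, by induction on the number n of topplings after which an unfinished branch is charged
    1. Conditioning on the next step amounts to extending the history by the new vertex and by the
    set of uniform values that decides the fate of the loop. *)
Lemma covered_bad_from l a D f0 e : 0 < e -> a \notin D -> uniq D -> good f0 ->
  (forall H f, measurable_history H -> (forall b, b \notin a :: D -> H b = [::]) -> good f ->
     covered P (regular `&` history_event X Y (a :: D) H `&` bad l f)
       (history_weight G (a :: D) H * (h f + e))) ->
  forall n H f, measurable_history H -> (forall b, b \notin a :: D -> H b = [::]) ->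
  phase_state f0 a f (last a (unzip1 (H a))) ->
  covered P (regular `&` history_event X Y (a :: D) H `&` bad_from a (size (H a)) l f)
    (history_weight G (a :: D) H * (h f + surv a n f + e)).
Proof.
move=> e0 aD uD g0 next; elim=> [|n IH] H f mH nH st; set W := history_weight G _ H.
all: have W0 : 0 <= W by exact: history_weight_ge0.
all: have [fa|fa] := pselect (final f a).
1,3: have gf : good f by case: st => [[]//|[Q bf _]]; case: (branch_not_final bf).
1,2: apply: covered_sub (next H f mH nH gf) _ _ => [t [rt]|]; last by
  rewrite ler_wpM2l // lerD2r lerDl surv_ge0.
1,2: by move=> hb; split=> //; apply: hb; exact: completes_final.
  (* No toppling is left and the branch is unfinished: [surv] is 1, so the whole history event can
     be paid for. *)
  apply: (@covered_sub _ _ _ P _ (history_event X Y (a :: D) H) W).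
  - exists (history_event X Y (a :: D) H); split=> //.
      exact: (measurable_history_event drv _ mH).
    by rewrite (prob_history_event drv) //= aD.
  - by move=> t [[]].
  - rewrite ler_peMr // {1}/surv run0 // addrAC lerDr.
    by rewrite addr_ge0 ?h_ge0 // ltW.
case: st => [[_ /fa//]|[Q bf lQ]].
set u := last a (unzip1 (H a)) in lQ.
have fu : f u = None by rewrite -lQ; exact: branch_tip_None bf.
set k := fun f' => h f' + surv a n f' + e.
have tipu : tip f a = u by rewrite (branch_tip bf) lQ.
apply: (@covered_sub _ _ _ P _ _ (\sum_(v <- nbrs G u)
  W * (srw_step R G u v * topple_to p u v k f))).
- apply: (@covered_sum _ _ _ P _ _ (fun v => regular `&`
    history_event X Y (a :: D) H `&` bad_from a (size (H a)) l f `&`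
    [set t | X a (size (H a)).+1 t = v])) => v _.
  have step C f' : measurable C -> phase_state f0 a f' v ->
      covered P (regular `&` history_event X Y (a :: D) (extend H a v C) `&`
        bad_from a (size (H a)).+1 l f') (W * (srw_step R G u v * unif C) * k f').
    move=> mC st'; rewrite -history_weight_extend //.
    have := IH (extend H a v C) f' (measurable_extend _ _ mH mC) _ _.
    rewrite /extend eqxx size_rcons /unzip1 map_rcons last_rcons /=; apply=> //.
    by move=> b bD; rewrite ifN ?nH //; apply: contraNneq bD => ->; exact: mem_head.
  have [vu|vu] := pselect (leads f v u).
    rewrite topple_to_leads //; set q := loop_weight p _.
    have q01 : 0 <= q <= 1 by exact: loop_weight01.
    have c1 := step _ _ (measurable_le_set q) (phase_upd v g0 bf lQ).
    have c2 := step _ _ (measurable_gt_set q) (phase_clear g0 bf lQ vu).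
    apply: covered_sub (coveredU c1 c2) _ _; last first.
      rewrite unif_le // unif_gt //.
      by rewrite le_eqVlt; apply/orP; left; apply/eqP; ring.
    move=> t [[[rt ht] bt] tv].
    have Xu : X a (size (H a)) t = u by exact: history_event_last ht.
    have [yq|qy] := leP (Y a (size (H a)).+1 t) q; [left|right].
      split; first by split=> //; rewrite -tv; exact: history_event_extend.
      move=> g cg; apply: bt; apply: completes_step => //.
      by rewrite Xu tv /step_to asboolT //= ltNge yq.
    split; first by split=> //; rewrite -tv; exact: history_event_extend.
    move=> g cg; apply: bt; apply: completes_step => //.
    by rewrite Xu tv /step_to asboolT //= qy.
  rewrite topple_to_fresh //.
  have c := step setT _ measurableT (phase_upd v g0 bf lQ).
  apply: covered_sub c _ _; last by rewrite unifT mulr1 mulrA.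
  move=> t [[[rt ht] bt] tv].
  have Xu : X a (size (H a)) t = u by exact: history_event_last ht.
  split; first by split=> //; rewrite -tv; exact: history_event_extend.
  move=> g cg; apply: bt; apply: completes_step => //.
  by rewrite Xu tv /step_to asboolF.
- move=> t [[rt ht] bt]; exists (X a (size (H a)).+1 t) => //.
  by rewrite mem_nbrs /u -(history_event_last ht); exact: (rt a).2.
rewrite -mulr_sumr -/(avg _ _ _) ler_wpM2l //.
(* Toppling is linear: it does not increase h, and it turns [surv] for n topplings into [surv] for n
   + 1. *)
have -> : avg G u (fun v => topple_to p u v k f) =
    topple p u h f + topple p u (surv a n) f + avg G u (fun=> e).
  rewrite /topple -!avgD; apply: eq_avg => v _; rewrite /topple_to.
  by case: ifP => _; rewrite /k; ring.
apply: lerD; last by apply: avg_le => //; exact: ltW.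
by apply: lerD; [exact: h_topple|rewrite [leRHS]/surv runS // tipu].
Qed.

(** When no walk is left this is Markov's inequality, since a bad state has value at least 1. Half
    of e pays for truncating the current phase, the other half for the remaining ones. *)
Lemma covered_bad l D H f e : 0 < e -> uniq (l ++ D) -> measurable_history H ->
  (forall b, b \notin D -> H b = [::]) -> good f ->
  covered P (regular `&` history_event X Y D H `&` bad l f)
    (history_weight G D H * (h f + e)).
Proof.
elim: l D H f e => [|a l IH] D H f e e0 ulD mH nH gf.
  have [hf|hf] := leP 1 (h f); last first.
    apply: covered_sub (covered0 _ _) _ (lexx _) => [|t [_ bt]].
      by rewrite mulr_ge0 ?history_weight_ge0 // addr_ge0 // ltW.
    by have := bt _ (builds_nil _ _ _ _); rewrite leNgt hf.
  apply: (@covered_sub _ _ _ P _ (history_event X Y D H) (history_weight G D H)).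
  - exists (history_event X Y D H); split=> //; first exact: (measurable_history_event drv _ mH).
    by rewrite (prob_history_event drv ulD mH).
  - by move=> t [[]].
  - by rewrite ler_peMr ?history_weight_ge0 // (le_trans hf) // lerDl ltW.
have uD : uniq D by move: ulD; rewrite cat_uniq => /and3P[].
have aD : a \notin D by move: ulD; rewrite /= mem_cat negb_or => /andP[/andP[]].
have e2 : 0 < e / 2 by rewrite divr_gt0.
have [n small] : exists n, surv a n f <= e / 2.
  have [fa|fa] := pselect (f a = None); last first.
    by exists 0%N; rewrite /surv run_final ?ltW //; exact: gf.
  move/cvgrPdist_le : (survival a) => /(_ _ e2)[n _ nP]; exists n.
  have := nP n (leqnn n); rewrite /= sub0r normrN; apply: le_trans.
  apply: le_trans (ler_norm _); have bf := branch0 fa.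
  apply: (le_trans (unfinished_le_alive p01 n gf bf)).
  by apply: ler_walk_sum => s _ _; exact: alive_le_sup.
have Ha : H a = [::] by exact: nH.
have st : phase_state f a f (last a (unzip1 (H a))).
  rewrite Ha; have [fa|fa] := pselect (f a = None).
    by right; exists [:: a] => //; exact: branch0.
  by left; split=> //; exact: gf.
have nH' b : b \notin a :: D -> H b = [::].
  by rewrite inE negb_or => /andP[_]; exact: nH.
have next H' f' : measurable_history H' -> (forall b, b \notin a :: D -> H' b = [::]) ->
    good f' -> covered P (regular `&` history_event X Y (a :: D) H' `&` bad l f')
      (history_weight G (a :: D) H' * (h f' + e / 2)).
  move=> mH' nH'' gf'; apply: IH => //.
  by rewrite -(cat1s a D) uniq_catCA.
have cov := covered_bad_from e2 aD uD gf next n mH nH' st.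
apply: covered_sub cov _ _ => [t [[rt ht] bt]|].
  split; first split=> //.
    move=> b; rewrite inE => /orP[/eqP->|]; last exact: ht.
    by rewrite /walk_event /unif_event Ha /=; split=> //; split=> //; exact: (rt a).1.
  by move=> g; rewrite Ha => cg k bk; apply: bt; exact: builds_cons cg bk.
rewrite {1}/history_weight big_cons Ha big_nil mulr1 mul1r -/(history_weight G D H).
rewrite ler_wpM2l ?history_weight_ge0 // -addrA lerD2l.
by rewrite [leRHS]splitr lerD2r.
Qed.

(** Applied with h = 0 to show that the walks stop, and with h = [reach_lim] to bound the
    probability of being an ancestor. *)
Lemma covered_bad_empty l e : 0 < e -> uniq l ->
  covered P (regular `&` bad l (fun=> None)) (h (fun=> None) + e).
Proof.
move=> e0 ul; have ul0 : uniq (l ++ [::]) by rewrite cats0.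
have mH : measurable_history (fun _ : V => [::] : seq (V * set R)).
  by move=> b i; rewrite nth_nil; exact: measurableT.
have c := covered_bad e0 ul0 mH (fun b _ => erefl) (@good_empty V).
apply: covered_sub c _ _ => [t [rt bt]|]; first by split=> //; split.
by rewrite /history_weight big_nil mul1r.
Qed.

End Supermartingale.
(** * Measurability *)

Section CountableMeasurability.
Variables (d : measure_display) (T : measurableType d).

Lemma measurable_exists (I : countType) (A : I -> set T) :
  (forall i, measurable (A i)) -> measurable [set t | exists i, A i t].
Proof.
move=> mA; pose B n := if choice.unpickle n is Some i then A i else set0.
rewrite (_ : [set t | _] = \bigcup_n B n).
  by apply: bigcupT_measurable => n; rewrite /B; case: (choice.unpickle n : option I).
apply/seteqP; split=> [t [i At]|t [n _]].
  by exists (choice.pickle i) => //; rewrite /B choice.pickleK.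
by rewrite /B; case: (choice.unpickle n : option I) => // i At; exists i.
Qed.

Lemma measurable_forall (I : countType) (A : I -> set T) :
  (forall i, measurable (A i)) -> measurable [set t | forall i, A i t].
Proof.
move=> mA; rewrite (_ : [set t | _] = ~` [set t | exists i, (~` A i) t]).
  by apply: measurableC; apply: measurable_exists => i; exact: measurableC.
apply/seteqP; split=> [t At [i]|t h i]; first by apply.
by apply: contrapT => nA; apply: h; exists i.
Qed.

Lemma negligible_exists (R : realType) (mu : {measure set T -> \bar R}) (I : countType)
    (A : I -> set T) : (forall i, mu.-negligible (A i)) ->
  mu.-negligible [set t | exists i, A i t].
Proof.
move=> nA; pose B n := if choice.unpickle n is Some i then A i else set0.
apply: (@negligibleS _ _ _ _ (\bigcup_n B n)).
  by move=> t [i At]; exists (choice.pickle i) => //; rewrite /B choice.pickleK.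
apply: negligible_bigcup => n; rewrite /B.
by case: (choice.unpickle n : option I) => [i|]; [exact: nA|exact: negligible_set0].
Qed.

(** Z factors through a measurable integer code. No sigma-algebra on U is involved, so propositions
    and sets of vertices are admissible values. *)
Definition discrete (U : Type) (Z : T -> U) := exists (c : T -> nat) (k : nat -> U),
  (forall i, measurable [set t | c t = i]) /\ forall t, Z t = k (c t).

Lemma discrete_preimage U (Z : T -> U) (Q : U -> Prop) :
  discrete Z -> measurable [set t | Q (Z t)].
Proof.
move=> [c [k [mc Zk]]]; rewrite (_ : [set t | _] = \bigcup_(i in [set i | Q (k i)]) [set t | c t = i]).
  by apply: bigcup_measurable => i _.
apply/seteqP; split=> [t /=|t [i /= Qi]].
  by rewrite Zk => Qt; exists (c t).
by rewrite Zk => ->.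
Qed.

Lemma discrete_map U U' (F : U -> U') (Z : T -> U) : discrete Z -> discrete (fun t => F (Z t)).
Proof. by move=> [c [k [mc Zk]]]; exists c, (F \o k); split=> // t; rewrite Zk. Qed.

Lemma discrete_count (I : countType) (Z : T -> I) :
  (forall i, measurable [set t | Z t = i]) -> discrete Z.
Proof.
move=> mZ; exists (fun t => choice.pickle (Z t)), (fun n => odflt (Z point) (choice.unpickle n)).
split=> [n|t]; last by rewrite choice.pickleK.
case E : (choice.unpickle n : option I) => [i|].
  have [pi|pi] := eqVneq (choice.pickle i) n.
    rewrite (_ : [set t | _] = [set t | Z t = i]) //.
    apply/seteqP; split=> t /=; last by move=> ->.
    by rewrite -pi => /(congr1 (@choice.unpickle I)); rewrite !choice.pickleK => -[].
  rewrite (_ : [set t | _] = set0) //; apply/seteqP; split=> t //= e.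
  by move: E pi; rewrite -e choice.pickleK => -[->]; rewrite eqxx.
rewrite (_ : [set t | _] = set0) //; apply/seteqP; split=> t //= e.
by move: E; rewrite -e choice.pickleK.
Qed.

Lemma discrete_pair U U' (Z : T -> U) (Z' : T -> U') :
  discrete Z -> discrete Z' -> discrete (fun t => (Z t, Z' t)).
Proof.
move=> [c [k [mc Zk]]] [c' [k' [mc' Zk']]].
have dc : discrete (fun t => (c t, c' t)).
  apply: discrete_count => -[i i'].
  rewrite (_ : [set t | _] = [set t | c t = i] `&` [set t | c' t = i']).
    exact: measurableI.
  by apply/seteqP; split=> t /= [-> ->].
have := discrete_map (fun ij => (k ij.1, k' ij.2)) dc.
by congr discrete; apply/funext => t; rewrite /= -Zk -Zk'.
Qed.

Lemma discrete_bool (b : T -> bool) : measurable [set t | b t] -> discrete b.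
Proof.
move=> mb; apply: discrete_count => -[] //.
rewrite (_ : [set t | _] = ~` [set t | b t]); first exact: measurableC.
by apply/seteqP; split=> t /=; case: (b t).
Qed.

Lemma discrete_cst U (u : U) : discrete (fun _ : T => u).
Proof.
exists (fun=> 0%N), (fun=> u); split=> // -[|i].
  by rewrite (_ : [set t | _] = setT) //; apply/seteqP; split.
by rewrite (_ : [set t | _] = set0) //; apply/seteqP; split.
Qed.

End CountableMeasurability.

(** * Measurability of the random configuration *)

Section WilsonMeasurability.
Variables (R : realType) (V : countType) (G : lfgraph V) (p : ocycle G -> R).
Variables (d : measure_display) (T : measurableType d).

Section Lerw.
Variables (X : nat -> T -> V) (Y : nat -> T -> R) (W : T -> set V).
Hypothesis mX : forall n y, measurable [set t | X n t = y].
Hypothesis mY : forall n q, measurable [set t | Y n t <= q].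
Hypothesis dW : discrete W.
Let lerw_at n t := lerw p (X ^~ t) (Y ^~ t) (W t) n.
Let stopped_at n t := lerw_stopped p (X ^~ t) (Y ^~ t) (W t) n.

Lemma discrete_hit_by n : discrete (fun t => hit_by (X ^~ t) (W t) n).
Proof.
have dX : discrete (fun t => [seq X i t | i <- iota 0 n.+1]).
  elim: (iota 0 n.+1) => [|i r IH] /=; first exact: discrete_cst.
  exact: (discrete_map (fun xs => xs.1 :: xs.2) (discrete_pair (discrete_count (mX i)) IH)).
have := discrete_map (fun xw => exists2 x, x \in xw.1 & xw.2 x) (discrete_pair dX dW).
congr discrete; apply/funext => t /=; apply/propext; split.
  case=> x xs Wx; have /seq.mapP[i] : x \in [seq X i t | i <- iota 0 n.+1] := xs.
  by rewrite mem_iota add0n ltnS => iN e; exists i; rewrite -?e.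
move=> [i iN Wx]; exists (X i t) => //.
have ii : i \in iota 0 n.+1 by rewrite mem_iota add0n ltnS.
exact: (map_f (X ^~ t) ii).
Qed.

Lemma discrete_lerw n : discrete (lerw_at n).
Proof.
elim: n => [|n IH]; first exact: (discrete_map (fun x => ([:: x], None)) (discrete_count (mX 0))).
pose q (st : lerw_state V) v := loop_weight p (drop (index v st.1) st.1).
have dZ := discrete_pair (discrete_pair IH (discrete_hit_by n)) (discrete_count (mX n.+1)).
(* The uniform variable is not discrete, but only its comparison with the weight of the closed loop
   matters, and this weight depends on discrete data. *)
have db : discrete (fun t => Y n.+1 t <= q (lerw_at n t) (X n.+1 t)).
  apply: discrete_bool; case: dZ => c [k [mc Zk]].
  rewrite (_ : [set t | _] = [set t | exists i, ([set t | c t = i] `&`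
      [set t | Y n.+1 t <= q (k i).1.1 (k i).2]) t]).
    by apply: measurable_exists => i; apply: measurableI.
  apply/seteqP; split=> t /=.
    by move=> h; exists (c t); split=> //; rewrite -Zk.
  by move=> [i [e]]; rewrite -e -Zk.
pose F (z : lerw_state V * Prop * V * bool) : lerw_state V :=
  let: (st, hit, v, b) := z in
  if isSome st.2 || `[< hit >] then st
  else if v \notin st.1 then (rcons st.1 v, None)
  else if b then (st.1, Some (close_seq (drop (index v st.1) st.1)))
  else (take (index v st.1).+1 st.1, None).
have := discrete_map F (discrete_pair dZ db).
by congr discrete; apply/funext => t.
Qed.

Lemma measurable_stopped n : measurable (stopped_at n).
Proof.
have := discrete_preimage (fun z => isSome z.1.2 \/ z.2)
  (discrete_pair (discrete_lerw n) (discrete_hit_by n)).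
by congr measurable.
Qed.

(** The choice of a stopping time is immaterial, since the state is frozen afterwards. *)
Definition final_lerw t : option (lerw_state V) :=
  if pselect (exists n, stopped_at n t) is left h then Some (lerw_at (projT1 (cid h)) t)
  else None.

Lemma final_lerw_Some t n : stopped_at n t -> final_lerw t = Some (lerw_at n t).
Proof.
move=> sn; rewrite /final_lerw; case: pselect => [h|[]]; last by exists n.
by case: cid => m /= sm; rewrite /lerw_at (lerw_stopped_eq sm sn).
Qed.

Lemma discrete_final_lerw : discrete final_lerw.
Proof.
apply: (@discrete_count _ _ (option (seq V * option (seq V)))) => -[st|].
  rewrite (_ : [set t | _] = [set t | exists n, (stopped_at n `&` [set t | lerw_at n t = st]) t]).
    apply: measurable_exists => n; apply: measurableI; first exact: measurable_stopped.
    exact: (discrete_preimage (fun z => z = st) (discrete_lerw n)).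
  apply/seteqP; split=> t /=; last by move=> [n [sn e]]; rewrite (final_lerw_Some sn) e.
  rewrite /final_lerw; case: pselect => // h [e]; exists (projT1 (cid h)).
  by split=> //; exact: (projT2 (cid h)).
rewrite (_ : [set t | _] = ~` [set t | exists n, stopped_at n t]).
  by apply: measurableC; apply: measurable_exists; exact: measurable_stopped.
by apply/seteqP; split=> t /=; rewrite /final_lerw; case: pselect.
Qed.

Lemma lerw_vertices_final t : lerw_vertices p (X ^~ t) (Y ^~ t) (W t) =
  if final_lerw t is Some st then state_vertices st else set0.
Proof.
have [[n sn]|h] := pselect (exists n, stopped_at n t).
  by rewrite (final_lerw_Some sn) (lerw_vertices_stopped sn).
rewrite /final_lerw; case: pselect => // _.
by apply/seteqP; split=> // x [n sn]; case: h; exists n.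
Qed.

Lemma lerw_edges_final t : lerw_edges p (X ^~ t) (Y ^~ t) (W t) =
  if final_lerw t is Some st then state_edges st else set0.
Proof.
have [[n sn]|h] := pselect (exists n, stopped_at n t).
  by rewrite (final_lerw_Some sn) (lerw_edges_stopped sn).
rewrite /final_lerw; case: pselect => // _.
by apply/seteqP; split=> // x [n sn]; case: h; exists n.
Qed.

End Lerw.

Variables (v : nat -> V) (X : V -> nat -> T -> V) (Y : V -> nat -> T -> R).
Hypothesis mX : forall x n y, measurable [set t | X x n t = y].
Hypothesis mY : forall x n q, measurable [set t | Y x n t <= q].

Lemma discrete_wilson n :
  discrete (fun t => wilson p v (fun x m => X x m t) (fun x m => Y x m t) n).
Proof.
elim: n => [|n IH]; first exact: discrete_cst.
have dW := discrete_map fst IH.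
have dL := discrete_final_lerw (mX (v n)) (mY (v n)) dW.
have := discrete_map (fun z : (set V * set {fset V}) * option (lerw_state V) =>
  (z.1.1 `|` (if z.2 is Some st then state_vertices st else set0),
   z.1.2 `|` (if z.2 is Some st then state_edges st else set0))) (discrete_pair IH dL).
congr discrete; apply/funext => t /=.
by rewrite -lerw_vertices_final -lerw_edges_final.
Qed.

Lemma measurable_wilson_config :
  measurable_fun setT (fun t => wilson_config p v (fun x m => X x m t)
    (fun x m => Y x m t) : config G).
Proof.
apply: (@measurability _ _ T (config G) setT _ (@cylinders V G) erefl).
move=> _ [_ [e ->] <-]; rewrite setTI.
rewrite (_ : _ @^-1` _ = [set t | exists n, [set t |
   (wilson p v (fun x m => X x m t) (fun x m => Y x m t) n).2 (sval e)] t]).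
  apply: measurable_exists => n.
  exact: (discrete_preimage (fun z => z.2 (sval e)) (discrete_wilson n)).
by apply/seteqP; split=> t /= /asboolP.
Qed.

End WilsonMeasurability.

(** * Measurability of the finiteness of components *)

Section ConfigMeasurability.
Variables (V : countType) (G : lfgraph V).

Lemma measurable_open_edge x y : measurable [set eta : config G | open_edge eta x y].
Proof.
have [[e ee]|ne] := pselect (exists e : edge G, sval e = [fset x; y]%fset).
  rewrite (_ : [set eta | _] = [set eta : config G | eta e]).
    by apply: sub_sigma_algebra; exists e.
  apply/seteqP; split=> eta /=; last by move=> h; apply/asboolP; exists e.
  move=> /asboolP[e' e'e eta']; suff -> : e = e' by [].
  case: e e' ee e'e {eta'} => [e he] [e' he'] /= ee e'e; subst e e'.
  by congr exist; exact: Prop_irrelevance.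
rewrite (_ : [set eta | _] = set0) //; apply/seteqP; split=> eta //=.
by move=> /asboolP[e ee _]; apply: ne; exists e.
Qed.

Lemma measurable_open_path x s : measurable [set eta : config G | path (open_edge eta) x s].
Proof.
elim: s x => [|y s IH] x /=.
  by rewrite (_ : [set eta | _] = setT) //; apply/seteqP; split.
rewrite (_ : [set eta | _] = [set eta : config G | open_edge eta x y] `&`
  [set eta : config G | path (open_edge eta) y s]).
  by apply: measurableI; [exact: measurable_open_edge|exact: IH].
by apply/seteqP; split=> eta /= /andP.
Qed.

Lemma measurable_component x y : measurable [set eta : config G | component eta x y].
Proof.
rewrite (_ : [set eta | _] = [set eta : config G | exists s : seq V,
    ([set eta : config G | path (open_edge eta) x s] `&` [set _ | last x s = y]) eta]).
  apply: measurable_exists => s; apply: measurableI; first exact: measurable_open_path.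
  have [e|ne] := pselect (last x s = y).
    by rewrite (_ : [set _ | _] = setT) //; apply/seteqP; split.
  by rewrite (_ : [set _ | _] = set0) //; apply/seteqP; split.
by apply/seteqP; split=> eta [s]; [exists s|case; exists s].
Qed.

Lemma measurable_finite_components :
  measurable [set eta : config G | forall x, finite_set (component eta x)].
Proof.
apply: measurable_forall => x.
(* A set is finite when some list contains it, and there are countably many lists. *)
have -> : (fun eta : config G => finite_set (component eta x)) =
    [set eta : config G | exists s : seq V,
    [set eta : config G | forall y : V, [set eta : config G |
      component eta x y -> y \in s] eta] eta].
  apply/seteqP; split=> eta /=.
    by move=> /finite_seqP[s e]; exists s => y; rewrite e.
  by move=> [s h]; apply: (sub_finite_set _ (finite_seq s)).
apply: measurable_exists => s; apply: measurable_forall => y.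
change (measurable [set eta : config G | component eta x y -> y \in s]).
have [ys|ys] := boolP (y \in s).
  by rewrite (_ : [set _ | _] = setT) //; apply/seteqP; split.
rewrite (_ : [set _ | _] = ~` [set eta : config G | component eta x y]).
  by apply: measurableC; exact: measurable_component.
by apply/seteqP; split=> eta /= h // /h.
Qed.

End ConfigMeasurability.

(** * Null events, and the conclusion *)

Section AlmostSure.
Variables (R : realType) (V : countType) (G : lfgraph V) (p : ocycle G -> R).
Hypothesis p01 : forall c, 0 <= p c <= 1.
Hypothesis V_infinite : infinite_set [set: V].
Hypothesis G_connected : connected_graph G.
Hypothesis ula : uniform_loop_assumption p.
Variables (d : measure_display) (T : measurableType d) (P : probability T R).
Variables (v : nat -> V) (X : V -> nat -> T -> V) (Y : V -> nat -> {RV P >-> R}).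
Hypothesis v_bij : bijective v.
Hypothesis drv : driving_families G X Y.
Notation first n := [seq v i | i <- iota 0 n].
Notation empty := (fun=> None).
Notation builds_at t n g := (builds_to p X Y t (first n) empty g).

Lemma covered_negligible (A : set T) :
  (forall e, 0 < e -> covered P A e) -> P.-negligible A.
Proof.
move=> h; have /choice[M MP] : forall n, exists M, [/\ measurable M, A `<=` M &
    (P M <= (n.+1%:R^-1 : R)%:E)%E].
  by move=> n; apply: h; rewrite invr_gt0.
have mM : measurable (\bigcap_n M n).
  by apply: bigcapT_measurable => n; have [] := MP n.
exists (\bigcap_n M n); split=> //; last by move=> t At n _; have [_ + _] := MP n; apply.
apply/eqP; rewrite eq_le measure_ge0 andbT; apply/lee_addgt0Pr => e e0.
have [n _ nP] := near_infty_natSinv_lt (PosNum e0).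
have [mn _ Pn] := MP n; rewrite add0e.
apply: (@le_trans _ _ (P (M n))).
  by apply: le_measure; rewrite ?inE // => t; apply.
by apply: (le_trans Pn); rewrite lee_fin ltW //; exact: (nP n (leqnn n)).
Qed.

(** There are countably many words, and one that is not a path of G has probability 0. *)
Lemma negligible_irregular : P.-negligible (~` regular G X).
Proof.
pose word x m t := [seq X x i t | i <- iota 1 m].
have null x m (w : seq V) : size w = m -> ~~ path (adj G) x w ->
    P.-negligible [set t | X x 0%N t = x /\ word x m t = w].
  move=> <- nw; case: drv => /(_ x)[mX _ /(_ w) e] _ _.
  have e0 : srw_prob R G x w = 0.
    apply/eqP; rewrite eq_le srw_prob_ge0 andbT leNgt.
    by apply: contra nw; exact: srw_prob_path.
  apply/negligibleP; last by apply: (etrans e); rewrite e0.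
  have mword : discrete (fun t => (X x 0%N t, word x (size w) t)).
    apply: discrete_pair; first exact: (discrete_count (mX 0%N)).
    rewrite /word; elim: (iota 1 _) => [|i r IH] /=; first exact: discrete_cst.
    exact: (discrete_map (fun xs => xs.1 :: xs.2) (discrete_pair (discrete_count (mX i)) IH)).
  exact: (discrete_preimage (fun z : V * seq V => z.1 = x /\ z.2 = w) mword).
apply: (@negligibleS _ _ _ _ ([set t | exists x, (~` [set t | X x 0%N t = x]) t] `|`
    [set t | exists xw : V * seq V, [set t | ~~ path (adj G) xw.1 xw.2 /\
       X xw.1 0%N t = xw.1 /\ word xw.1 (size xw.2) t = xw.2] t])).
  move=> t nr; apply: contrapT => h; apply: nr => x.
  have X0 : X x 0%N t = x.
    by apply: contrapT => nX; apply: h; left; exists x.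
  split=> // m; have pw n : path (adj G) x (word x n t).
    apply: contrapT => /negP np; apply: h; right; exists (x, word x n t).
    by rewrite /= size_map size_iota.
  have := pw m.+1; rewrite /word -{1}(addn1 m) iotaD map_cat cat_path => /andP[_].
  rewrite /= andbT add1n; congr adj.
  case: m => [|m]; first by rewrite X0.
  by rewrite -{1}(addn1 m) iotaD map_cat last_cat /= add1n.
apply: negligibleU.
  apply: negligible_exists => x; case: drv => /(_ x)[mX X0 _] _ _.
  apply/negligibleP; first by apply: measurableC; exact: mX.
  have e : (P (~` [set t | X x 0%N t = x]) = 0)%E.
    by rewrite probability_setC ?X0 ?subee //; exact: mX.
  exact: e.
apply: negligible_exists => -[x w] /=.
have [pw|pw] := boolP (path (adj G) x w).
  by apply: negligibleS (negligible_set0 _) => t [].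
by apply: negligibleS (null x (size w) w erefl pw) => t [_].
Qed.

Lemma uniq_first n : uniq (first n).
Proof. by rewrite map_inj_uniq ?iota_uniq //; exact: bij_inj. Qed.

(** For h = 0 no state has value 1, so [bad] is the event that some walk does not stop. *)
Lemma negligible_unstopped n :
  P.-negligible (regular G X `&` [set t | forall g, ~ builds_at t n g]).
Proof.
apply: covered_negligible => e e0.
have t0 f u : f u = None -> topple p u (fun=> 0) f <= (0 : R).
  by move=> _; apply: avg_le => // w _; exact: topple_to_le.
have c := covered_bad_empty p01 drv (survival_cvg0 p01 V_infinite G_connected ula)
  (fun=> lexx 0) t0 e0 (uniq_first n).
apply: covered_sub c _ _; last by rewrite add0r.
by move=> t [rt nb]; split=> // g /nb.
Qed.

Definition far_ancestor z (K : {fset V}) : set T := [set t | exists n g,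
  [/\ builds_at t n.+1 g, v n \in bdry G K & descends g (v n) z]].

(** The event requires a far ancestor for every K, so for each e it is enough to look at one K,
    chosen with a small sum of hitting probabilities. *)
Lemma negligible_far_ancestors z : P.-negligible (regular G X `&`
  [set t | forall K : {fset V}, z \in K -> far_ancestor z K t]).
Proof.
apply: covered_negligible => e e0; have [v' vK v'K] := v_bij.
have e2 : 0 < e / 2 by rewrite divr_gt0.
have [K zK small] := sum_reach_small p01 V_infinite G_connected ula z e2.
(* The slacks over all boundary vertices add up to at most e / 2; the successor takes care of an
   empty boundary. *)
pose e' := e / 2 / (size (bdry G K)).+1%:R.
have e'0 : 0 < e' by rewrite divr_gt0.
have cov y : covered P (regular G X `&` bad p X Y (fun f => reach_lim p y z f)
    (first (v' y).+1) empty) (reach_lim p y z empty + e').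
  apply: (covered_bad_empty p01 drv) => //.
  - exact: survival_cvg0.
  - by move=> f; exact: reach_lim_ge0.
  - by move=> f u fu; exact: reach_lim_topple.
  - exact: uniq_first.
apply: covered_sub (covered_sum (fun y (_ : y \in bdry G K) => cov y)) _ _.
  move=> t [rt far]; have [n [g [bg vn dz]]] := far K zK.
  exists (v n) => //; split=> // g' bg'.
  have -> : g' = g by apply: builds_fun bg' _; rewrite vK.
  have [g0 _ /completes_end fg] := (builds_succ _ _ _ _ _ _).1 bg.
  (* Right after the phase of y its branch is final, so [reach_lim] is the indicator that z lies on
     it. *)
  by rewrite reach_lim_final // /hits asboolT.
rewrite big_split /= [leRHS]splitr lerD // big_const_seq count_predT iter_addr_0.
by rewrite -[leLHS]mulr_natr /e' mulrAC ler_pdivrMr // ler_wpM2l ?ler_nat // ltW.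
Qed.

Lemma finite_components_ae : P.-negligible [set t | ~ forall x, finite_set
  (component (G := G) (wilson_config p v (fun x n => X x n t) (fun x n => Y x n t)) x)].
Proof.
apply: (@negligibleS _ _ _ _ (~` regular G X `|`
  ([set t | exists n, (regular G X `&` [set t | forall g, ~ builds_at t n g]) t] `|`
   [set t | exists z, (regular G X `&` [set t | forall K : {fset V}, z \in K ->
     far_ancestor z K t]) t]))); last first.
  apply: negligibleU; first exact: negligible_irregular.
  apply: negligibleU; apply: negligible_exists.
    exact: negligible_unstopped.
  exact: negligible_far_ancestors.
move=> t nf; apply: contrapT => h; apply: nf.
have rt : regular G X t by apply: contrapT => nr; apply: h; left.
apply: finite_components v_bij _ _.
- by move=> x; exact: (rt x).1.
- by move=> x; exact: (rt x).2.
- move=> n; apply: contrapT => ns; apply: h; right; left; exists n; split=> // g bg.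
  by apply: ns; exists g.
- move=> z; apply: contrapT => nz; apply: h; right; right; exists z; split=> // K zK.
  apply: contrapT => nfar; apply: nz; exists K => // n g bg vn dz.
  by apply: nfar; exists n, g.
Qed.

End AlmostSure.

Theorem theorem4p1p4 (R : realType) (V : countType) (G : lfgraph V)
    (p : ocycle G -> R) (mu : probability (config G) R) :
  infinite_set [set: V] ->
  connected_graph G ->
  (forall c, 0 <= p c <= 1) ->
  uniform_loop_assumption p ->
  is_mu p mu ->
  {ae mu, forall eta : config G, forall x : V, finite_set (component eta x)}.
Proof.
move=> V_inf G_conn p01 ula [v [d [T [P [X [Y [v_bij drv law]]]]]]].
(* The law of the forest is given on measurable sets only, so the exceptional set has to be
   measurable. *)
pose NC := ~` [set eta : config G | forall x, finite_set (component eta x)].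
have mNC : measurable NC by apply: measurableC; exact: measurable_finite_components.
suff : mu.-negligible NC by [].
apply/negligibleP => //; apply: (etrans (law NC mNC)).
have mX x n y : measurable [set t | X x n t = y].
  by case: drv => /(_ x)[+ _ _] _ _; exact.
have mY x n q : measurable [set t | Y x n t <= q].
  have := measurable_funPT (Y x n) measurableT _ (measurable_le_set q).
  by rewrite setTI.
have mW := measurable_wilson_config p v mX mY.
apply/negligibleP.
  by have := mW measurableT _ mNC; rewrite setTI.
by apply: negligibleS (finite_components_ae p01 V_inf G_conn ula v_bij drv) => t.
Qed.
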